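(* Let $\mathbf{S}=(S(t))_{t\ge 0}$ be a strongly continuous semigroup on a Banach space $X$ with generator $A$. Then the following assertions are equivalent: \begin{enumerate} \item $A_{-1}$ is an $\mathrm{L}^{\infty}$-admissible control operator for $\mathbf{S}$; \item $Fav(\mathbf{S})=D(A)$ and $\mathbf{S}$ satisfies $\mathrm{C}$-maximal-regularity; \item $A$ is a bounded operator. \end{enumerate}
   Context: All normed spaces are complex. $D(A)$ denotes the domain of $A$, $\rho(A)$ its resolvent set, and $R(\lambda,A)=(\lambda-A)^{-1}$ for $\lambda\in\rho(A)$. The space $X_{-1}$ is the completion of $X$ with respect to the norm $\|R(\lambda,A)\cdot\|$ for some fixed $\lambda\in\rho(A)$. The semigroup $\mathbf{S}$ extends uniquely to a strongly continuous semigroup $\mathbf{S}_{-1}=(S_{-1}(t))_{t\ge0}$ on $X_{-1}$, whose generator $A_{-1}$ extends $A$ and has domain $D(A_{-1})=X$; thus $A_{-1}$ is a bounded linear operator from $X$ to $X_{-1}$. $\mathrm{L}^\infty([0,\tau],X)$ is the Lebesgue--Bochner space of (equivalence classes of) essentially bounded strongly measurable functions $[0,\tau]\to X$, and $\mathrm{C}([0,\tau],X)$ is the space of continuous functions with the supremum norm. Admissibility: for a Banach space $U$, a bounded linear operator $B:U\to X_{-1}$ is called an $\mathrm{L}^\infty$-admissible control operator for $\mathbf{S}$ if for some (hence all) $\tau>0$ the mapping $$\Phi_\tau:\mathrm{L}^\infty([0,\tau],U)\to X_{-1},\qquad u\mapsto\int_0^\tau S_{-1}(\tau-t)Bu(t)\,\mathrm{d}t$$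 has range contained in $X$. In the claim this is applied with $U=X$ and $B=A_{-1}$. Maximal regularity: $\mathbf{S}$ satisfies $\mathrm{C}$-maximal-regularity if for some $\tau>0$ and all $f\in \mathrm{C}([0,\tau],X)$ it holds that $(\mathbf{S}\ast f)(t)\in D(A)$ for almost every $t\in(0,\tau)$ and $A(\mathbf{S}\ast f)\in \mathrm{C}([0,\tau],X)$, where $(\mathbf{S}\ast f)(t):=\int_0^t S(t-s)f(s)\,\mathrm{d}s$. Equivalently, $\mathbf{S}\ast f\in \mathrm{C}([0,\tau],X_1)$ for all such $f$, where $X_1$ is $D(A)$ with the graph norm of $A$. The Favard space of $\mathbf{S}$ is $Fav(\mathbf{S}):=\{x\in X:\limsup_{t\to0^+}\frac1t\|S(t)x-x\|<\infty\}$. *)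

(* Defs.v *)
From mathcomp Require Import all_boot all_order all_algebra complex.
From mathcomp Require Import all_classical all_reals all_analysis.
Import Order.TTheory GRing.Theory Num.Theory.
Import numFieldNormedType.Exports.

Set Implicit Arguments.
Unset Strict Implicit.
Unset Printing Implicit Defensive.

Local Open Scope classical_set_scope.
Local Open Scope ring_scope.
Local Open Scope complex_scope.

(* The norm of a normed module over R[i] takes (real) values in R[i]; [rnorm]
   is the same norm with values in R. *)
Definition rnorm (R : realType) (V : normedModType R[i]) (x : V) : R :=
  complex.Re `|x|.

Definition bounded_linear (R : realType) (V W : normedModType R[i])
    (f : V -> W) : Prop :=
  linear f /\ exists M : R, forall x, rnorm (f x) <= M * rnorm x.

(* Only the values S t with 0 <= t are constrained, or used anywhere below. *)
Record c0semigroup (R : realType) (X : completeNormedModType R[i]) := C0Semigroup {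
  sg :> R -> X -> X ;
  sg_bounded : forall t, 0 <= t -> bounded_linear (sg t) ;
  sg0 : forall x, sg 0 x = x ;
  sgD : forall s t, 0 <= s -> 0 <= t -> forall x, sg (s + t) x = sg s (sg t x) ;
  sg_continuous : forall x, {within `[0, +oo[, continuous (fun t : R => sg t x)}
}.

Section Generator.
Context (R : realType) (X : completeNormedModType R[i]) (S : c0semigroup X).

Definition diff_quotient (x : X) (h : R) : X := (h^-1)%:C *: (S h x - x).

(* The generator A is represented by its domain D(A) and by a total function
   that is meaningful on D(A) only. *)
Definition gen_dom : set X := [set x | cvg (diff_quotient x h @[h --> 0^'+])].

Definition gen (x : X) : X := lim (diff_quotient x h @[h --> 0^'+]).

(* R(l, A) x is the solution y in D(A) of (l - A) y = x. *)
Definition resolvent (l : R[i]) (x : X) : X :=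
  xget 0 [set y | gen_dom y /\ l *: y - gen y = x].

Definition resolvent_set : set R[i] := [set l |
  (forall x, exists! y, gen_dom y /\ l *: y - gen y = x) /\
  bounded_linear (resolvent l)].

(* A is an everywhere defined bounded operator on X. *)
Definition bounded_generator : Prop :=
  gen_dom = setT /\ exists M : R, forall x, rnorm (gen x) <= M * rnorm x.

Definition favard : set X := [set x |
  (limf_esup (fun t : R => (t^-1 * rnorm (S t x - x))%:E) 0^'+ < +oo)%E].

End Generator.

Section Bochner.
Context (R : realType) (X : completeNormedModType R[i]).
Implicit Types (a b : R) (f s : R -> X).

Definition simple_function s : Prop :=
  finite_set (range s) /\ forall x, measurable (s @^-1` [set x]).

Definition simple_integral a b s : X :=
  \sum_(x \in [set: X])
    (fine (lebesgue_measure (`[a, b] `&` s @^-1` [set x])))%:C *: x.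

Definition strongly_measurable a b f : Prop :=
  exists2 s_ : nat -> R -> X, (forall n, simple_function (s_ n)) &
    {ae lebesgue_measure, forall t : R, `[a, b]%classic t ->
      s_ n t @[n --> \oo] --> f t}.

Definition is_bochner_integral a b f (v : X) : Prop :=
  strongly_measurable a b f /\
  exists s_ : nat -> R -> X, [/\ forall n, simple_function (s_ n),
    (\int[lebesgue_measure]_(t in `[a, b]) (rnorm (f t - s_ n t))%:E)%E
      @[n --> \oo] --> 0%E &
    simple_integral a b (s_ n) @[n --> \oo] --> v].

(* The value v is unique when it exists; the default 0 is used otherwise. *)
Definition bochner_integral a b f : X := xget 0 (is_bochner_integral a b f).

(* The representatives of the classes in L^oo([0, tau], X). *)
Definition Linfty (tau : R) : set (R -> X) := [set f |
  strongly_measurable 0 tau f /\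
  exists M : R, {ae lebesgue_measure, forall t : R, `[0, tau]%classic t ->
    rnorm (f t) <= M}].

End Bochner.

Section MaximalRegularity.
Context (R : realType) (X : completeNormedModType R[i]) (S : c0semigroup X).

Definition convolution (f : R -> X) (t : R) : X :=
  bochner_integral 0 t (fun s => S (t - s) (f s)).

(* A (S * f) is only defined almost everywhere; that it belongs to
   C([0, tau], X) means that it has a continuous representative g. *)
Definition C_maximal_regularity : Prop :=
  exists2 tau : R, 0 < tau &
    forall f : R -> X, {within `[0, tau], continuous f} ->
    exists2 g : R -> X, {within `[0, tau], continuous g} &
      {ae lebesgue_measure, forall t : R, `]0, tau[%classic t ->
        gen_dom S (convolution f t) /\ gen S (convolution f t) = g t}.

End MaximalRegularity.

Section Extrapolation.
Context (R : realType) (X : completeNormedModType R[i]) (S : c0semigroup X).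

(* (Y, j) is a completion of X for the norm |R(l, A) x|; completions are
   determined by this up to isometric isomorphism. *)
Definition is_extrapolation_space (l : R[i]) (Y : completeNormedModType R[i])
    (j : X -> Y) : Prop :=
  [/\ linear j, forall x, rnorm (j x) = rnorm (resolvent S l x) &
      dense (range j)].

Context (Y : completeNormedModType R[i]) (j : X -> Y).

(* By density of range j and boundedness of T t, this determines T t for t >= 0. *)
Definition extends_semigroup (T : c0semigroup Y) : Prop :=
  forall t, 0 <= t -> forall x, T t (j x) = j (S t x).

Context (T : c0semigroup Y) (U : completeNormedModType R[i]) (B : U -> Y).

Definition input_map (tau : R) (u : R -> U) : Y :=
  bochner_integral 0 tau (fun t => T (tau - t) (B (u t))).

(* X is identified with the subspace range j of Y. *)
Definition Linfty_admissible : Prop :=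
  bounded_linear B /\
  exists2 tau : R, 0 < tau &
    forall u, Linfty tau u -> range j (input_map tau u).

End Extrapolation.

(* Main.v *)
(* All three properties of the theorem are compared with regularity for bounded inputs:
   (S * v)(tau) lies in D(A) for every bounded v whose only discontinuity is at tau.

   Admissibility gives it because the input map sends v to A_{-1} (S * v)(tau), and a
   point z of X with A_{-1} z in X lies in D(A).  Under C-maximal regularity, a
   Banach-Steinhaus argument bounds A (S * u)(tau) by K sup |u| for continuous u; cutting v
   off near tau, (S * v)(tau) is the limit of points of D(A) with bounded images under A, so
   it lies in Fav(S) = D(A).

   Conversely, suppose that A is unbounded.  Then S is not norm continuous at 0, so there are
   bumps u_k of norm at most 1, with disjoint supports accumulating at tau, for which
   A (S * u_k)(tau) stays away from 0.  By a gliding hump argument, for a suitable choice of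
   the u_k the point (S * sum_k u_k)(tau) is not in D(A): the difference quotients of the
   semigroup at this point, at suitable times h_n, follow the divergent partial sums of
   sum_k A (S * u_k)(tau). *)
Require Import Defs.
From HB Require Import structures.
From mathcomp Require Import all_boot all_order all_algebra complex.
From mathcomp Require Import all_classical all_reals all_analysis.
From mathcomp Require Import measurable_realfun lra ring.
Import Order.TTheory GRing.Theory Num.Theory.
Import numFieldNormedType.Exports.

Set Implicit Arguments.
Unset Strict Implicit.
Unset Printing Implicit Defensive.

Local Open Scope classical_set_scope.
Local Open Scope ring_scope.
Local Open Scope complex_scope.

(** Inputs with a single discontinuity, at the right end, are a compromise. Their integrands are
    left continuous before [tau], so the Bochner integrals to be computed are limits of left Riemann
    sums; yet the class contains infinite sums of bumps that do not shrink. Continuous inputs are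
    too few: for [A e_n = - n e_n] on the space of null sequences, A is unbounded and has maximal
    regularity for continuous functions, while the Favard space ([n x_n] bounded) exceeds the domain
    ([n x_n] tending to 0). The Favard hypothesis carries regularity over to inputs jumping at
    [tau].

    The size of the bumps comes from a dichotomy at 1/2: if [|S(r) x - x| <= |x| / 2] for all small
    [r], then A is bounded; otherwise the indicator of an interval of length [r] ending at [tau],
    times a unit vector [x], yields [S(r) x - x] under A, and smoothing it costs at most 1/4.

    Divergence of [A W_n] does not by itself keep the limit of [W_n] out of the domain, even though
    A is closed; hence the control through difference quotients. The same construction serves the
    Banach-Steinhaus argument. *)

Section RealNorm.
Context (R : realType) (V : normedModType R[i]).
Implicit Types (x y : V) (r : R) (c : R[i]).

Lemma rnormE x : `|x| = (rnorm x)%:C.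
Proof. by rewrite /rnorm RRe_real// normr_real. Qed.

Lemma rnorm_ge0 x : 0 <= rnorm x.
Proof. by rewrite -ler0c -rnormE. Qed.

Lemma rnorm0 : rnorm (0 : V) = 0.
Proof. by rewrite /rnorm normr0. Qed.

Lemma rnormN x : rnorm (- x) = rnorm x.
Proof. by rewrite /rnorm normrN. Qed.

Lemma rnormD x y : rnorm (x + y) <= rnorm x + rnorm y.
Proof. by rewrite -lecR rmorphD/= -!rnormE ler_normD. Qed.

Lemma rnormB x y : rnorm (x - y) <= rnorm x + rnorm y.
Proof. by rewrite (le_trans (rnormD _ _))// rnormN. Qed.

Lemma rdistC x y : rnorm (x - y) = rnorm (y - x).
Proof. by rewrite -rnormN opprB. Qed.

Lemma rdist_tri y x z : rnorm (x - z) <= rnorm (x - y) + rnorm (y - z).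
Proof. by rewrite (le_trans _ (rnormD _ _))// subrKA. Qed.

Lemma rnorm_eq0 x : rnorm x = 0 -> x = 0.
Proof. by move=> x0; apply/eqP; rewrite -normr_eq0 rnormE x0. Qed.

Lemma rnormZc c x : rnorm (c *: x) = complex.Re `|c| * rnorm x.
Proof.
apply: (@complexI R); rewrite rmorphM/= -!rnormE normrZ; congr (_ * _).
Qed.

Lemma rnormZ r x : rnorm (r%:C *: x) = `|r| * rnorm x.
Proof.
by rewrite rnormZc; congr (_ * _); rewrite normc_def /= expr0n addr0 sqrtr_sqr.
Qed.

Lemma rnorm_sum I (s : seq I) (P : pred I) (F : I -> V) :
  rnorm (\sum_(i <- s | P i) F i) <= \sum_(i <- s | P i) rnorm (F i).
Proof.
elim/big_ind2: _ => [|x a y b xa yb|//]; first by rewrite rnorm0.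
by rewrite (le_trans (rnormD _ _))// lerD.
Qed.

Lemma rnorm_dist x y : `|rnorm x - rnorm y| <= rnorm (x - y).
Proof.
rewrite ler_norml; apply/andP; split.
  by have := rdist_tri x y 0; rewrite !subr0 rdistC; lra.
by have := rdist_tri y x 0; rewrite !subr0; lra.
Qed.

(** Positive elements of [R[i]] are real, so radii in the complex order can be traded for real ones;
    from here on the estimates are inequalities in [R]. *)
Lemma cvg_rnormP (T : Type) (F : set_system T) {FF : Filter F} (f : T -> V) l :
  f x @[x --> F] --> l <-> rnorm (f x - l) @[x --> F] --> (0 : R).
Proof.
split => [/cvgr_dist_lt fl|/cvgr0Pnorm_lt fl].
  apply/cvgr0Pnorm_lt => e e0; near=> x.
  rewrite ger0_norm ?rnorm_ge0// -ltcR -rnormE distrC; near: x.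
  by apply: fl; rewrite ltcR.
apply/cvgrPdist_lt => e e0.
have e0' : 0 < complex.Re e by move: e0; rewrite ltcE => /andP[].
have ee : e = (complex.Re e)%:C by rewrite RRe_real// ger0_real// ltW.
apply: filterS (fl _ e0') => x; rewrite ger0_norm ?rnorm_ge0// => fxl.
by rewrite distrC rnormE ee ltcR.
Unshelve. all: by end_near. Qed.

Lemma cvg_rnorm (T : Type) (F : set_system T) {FF : Filter F} (f : T -> V) l :
  f x @[x --> F] --> l -> rnorm (f x) @[x --> F] --> rnorm l.
Proof.
move/cvg_rnormP/cvgr0Pnorm_lt => fl; apply/cvgrPdist_lt => e e0.
apply: filterS (fl _ e0) => x; rewrite ger0_norm ?rnorm_ge0// => fxl.
by rewrite distrC (le_lt_trans (rnorm_dist _ _)).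
Qed.

Lemma cvg_rnorm_le (T : Type) (F : set_system T) {FF : Filter F} (f : T -> V)
    (g : T -> R) l :
  (\forall x \near F, rnorm (f x - l) <= g x) -> g x @[x --> F] --> (0 : R) ->
  f x @[x --> F] --> l.
Proof.
move=> fg g0; apply/cvg_rnormP.
apply: (@squeeze_cvgr _ _ _ _ (cst 0) g) => //; last exact: cvg_cst.
by apply: filterS fg => x ->; rewrite rnorm_ge0.
Qed.

Lemma rnorm_lim_le (T : Type) (F : set_system T) {FF : ProperFilter F} (f : T -> V)
    l (C : R) :
  f x @[x --> F] --> l -> (\forall x \near F, rnorm (f x) <= C) -> rnorm l <= C.
Proof.
move=> /cvg_rnorm fl fC; rewrite -(cvg_lim _ fl)//.
by apply: limr_le => //; apply: cvgP fl.
Qed.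

End RealNorm.

Section Complete.
Context (R : realType) (X : completeNormedModType R[i]).

Lemma cauchy_rnorm (T : Type) (F : set_system T) {FF : ProperFilter F} (f : T -> X) :
  (forall e : R, 0 < e -> exists a, \forall x \near F, rnorm (f x - a) < e) ->
  cvg (f x @[x --> F]).
Proof.
move=> H; apply/cauchy_cvgP/cauchy_exP => e e0.
have e0' : 0 < complex.Re e by move: e0; rewrite ltcE => /andP[].
have ee : e = (complex.Re e)%:C by rewrite RRe_real// ger0_real// ltW.
have [a fa] := H _ e0'; exists a.
rewrite nbhs_simpl/=; apply: filterS fa => x.
by rewrite -ball_normE/= => xa; rewrite ee rnormE ltcR rdistC.
Qed.

Lemma cauchy_seq_rnorm (f : nat -> X) (g : nat -> R) :
  (forall n m, (n <= m)%N -> rnorm (f m - f n) <= g n) ->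
  g n @[n --> \oo] --> (0 : R) -> cvg (f n @[n --> \oo]).
Proof.
move=> fg /cvgr0Pnorm_lt g0; apply: cauchy_rnorm => e e0.
have [N _ gN] := g0 _ e0; exists (f N); near=> n.
have nN : (N <= n)%N by near: n; exact: nbhs_infty_ge.
rewrite (le_lt_trans (fg _ _ nN))// (le_lt_trans (ler_norm _))//.
exact: gN (leqnn N).
Unshelve. all: by end_near. Qed.

End Complete.

Section BoundedLinear.
Context (R : realType) (V W : normedModType R[i]) (f : V -> W).
Hypothesis bf : bounded_linear f.

Let lf : {linear V -> W} :=
  HB.pack f (GRing.isLinear.Build _ _ _ _ f bf.1).

Lemma blin0 : f 0 = 0. Proof. exact: (linear0 lf). Qed.
Lemma blinD x y : f (x + y) = f x + f y. Proof. exact: (linearD lf). Qed.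
Lemma blinB x y : f (x - y) = f x - f y. Proof. exact: (linearB lf). Qed.
Lemma blinZ c x : f (c *: x) = c *: f x. Proof. exact: (linearZ_LR lf). Qed.
Lemma blin_sum I (s : seq I) (P : pred I) (F : I -> V) :
  f (\sum_(i <- s | P i) F i) = \sum_(i <- s | P i) f (F i).
Proof. exact: (linear_sum lf). Qed.

Lemma blin_bound : exists2 M : R, 1 <= M & forall x, rnorm (f x) <= M * rnorm x.
Proof.
have [_ [M HM]] := bf; exists (Num.max 1 M); first by rewrite le_max lexx.
move=> x; rewrite (le_trans (HM x))// ler_wpM2r ?rnorm_ge0//.
by rewrite le_max lexx orbT.
Qed.

Lemma blin_cvg (T : Type) (F : set_system T) {FF : Filter F} (u : T -> V) l :
  u x @[x --> F] --> l -> f (u x) @[x --> F] --> f l.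
Proof.
have [M M1 HM] := blin_bound.
move=> /cvg_rnormP ul; apply: (@cvg_rnorm_le _ _ _ _ _ _ (fun x => M * rnorm (u x - l))).
  by apply: nearW => x; rewrite -blinB.
by rewrite -[X in _ --> X](mulr0 M); apply: cvgM => //; exact: cvg_cst.
Qed.

End BoundedLinear.

(** * Bochner integrals *)

Section FiniteLabels.
Context (R : realType) (X : completeNormedModType R[i]).
Local Notation mu := (@lebesgue_measure R).

Lemma label_preimage (T : finType) (q : R -> T) :
  (forall t, measurable (q @^-1` [set t])) -> forall A, measurable (q @^-1` A).
Proof.
move=> mq A; have -> : q @^-1` A = \bigcup_(t in A) (q @^-1` [set t]).
  apply/seteqP; split => [r Ar|r [t At /= qr]]; first by exists (q r).
  by rewrite /= qr.
by apply: fin_bigcup_measurable => //; exact: finite_finset.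
Qed.

Lemma label_measurable_fun (T : finType) (q : R -> T) (rho : T -> R) :
  (forall t, measurable (q @^-1` [set t])) -> measurable_fun setT (rho \o q).
Proof.
move=> mq _ B mB; rewrite setTI comp_preimage.
exact: label_preimage.
Qed.

Lemma label_simple (T : finType) (q : R -> T) (phi : T -> X) :
  (forall t, measurable (q @^-1` [set t])) -> simple_function (phi \o q).
Proof.
move=> mq; split.
  apply: (@sub_finite_set _ _ (phi @` setT)) => [_ [r _ <-]|].
    by exists (q r).
  by apply: finite_image; exact: finite_finset.
by move=> x; rewrite comp_preimage; exact: label_preimage.
Qed.

Lemma fin_num_itv_measure (a b : R) A : measurable A ->
  mu (`[a, b] `&` A) \is a fin_num.
Proof.
move=> mA; rewrite ge0_fin_numE//.
apply: (@le_lt_trans _ _ (mu `[a, b])).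
  by apply: le_measure; rewrite ?inE//; exact: measurableI.
by rewrite lebesgue_measure_itv/=; case: ifPn => // _; rewrite -EFinB ltry.
Qed.

(** [simple_integral] sums over values, but several labels may carry the same value: labels are
    grouped by [phi t], and additivity of the measure merges each group. *)
Lemma label_integral (T : finType) (q : R -> T) (phi : T -> X) (a b : R) :
  (forall t, measurable (q @^-1` [set t])) ->
  simple_integral a b (phi \o q) =
  \sum_t (fine (mu (`[a, b] `&` q @^-1` [set t])))%:C *: phi t.
Proof.
move=> mq; rewrite /simple_integral.
pose s := undup [seq phi t | t : T].
rewrite -(@fsbig_widen _ _ _ _ [set` s]) //; last first.
  move=> x [_ /= xs]; rewrite (_ : _ `&` _ = set0) ?measure0 ?scale0r//.
  rewrite -subset0 => r [_ /= qr]; apply: xs.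
  by rewrite /= mem_undup -qr; apply/mapP; exists (q r); rewrite ?mem_enum.
rewrite -fsbig_seq ?undup_uniq//.
transitivity (\sum_(x <- s) \sum_(t | phi t == x)
    (fine (mu (`[a, b] `&` q @^-1` [set t])))%:C *: phi t).
  apply: eq_bigr => x _.
  rewrite (eq_bigr (fun t => (fine (mu (`[a, b] `&` q @^-1` [set t])))%:C *: x)); last first.
    by move=> t /eqP ->.
  rewrite -scaler_suml -rmorph_sum/= sum_fine; last first.
    by move=> t _; exact: fin_num_itv_measure.
  congr ((fine _)%:C *: _).
  transitivity (mu (\bigcup_(t in [set` [pred t | phi t == x]]) (`[a, b] `&` q @^-1` [set t]))).
    congr (mu _); apply/seteqP; split => [r [abr /= qr]|r [t /= /eqP <- [abr /= ->]]//].
    by exists (q r) => //=; apply/eqP.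
  rewrite measure_fin_bigcup//.
  - rewrite -(@bigfs _ _ _ _ (index_enum T))//; first exact: index_enum_uniq.
    by move=> t; rewrite mem_index_enum.
  - by move=> t1 t2 _ _ [r [[_ /= <-] [_ /= <-]]].
  - by move=> t _; apply: measurableI; [exact: measurable_itv|exact: mq].
rewrite (exchange_big_dep xpredT)//=; apply: eq_bigr => t _.
rewrite big_mkcond (bigD1_seq (phi t)) ?undup_uniq//= ?eqxx; last first.
  by rewrite mem_undup; apply/mapP; exists t; rewrite ?mem_enum.
by rewrite big1 ?addr0// => x; rewrite eq_sym => /negbTE ->.
Qed.

Lemma label_rintegral (T : finType) (q : R -> T) (rho : T -> R) (a b : R) :
  (forall t, measurable (q @^-1` [set t])) -> (forall t, 0 <= rho t) ->
  (\int[mu]_(r in `[a, b]) (rho (q r))%:E)%E =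
  (\sum_t fine (mu (`[a, b] `&` q @^-1` [set t])) * rho t)%:E.
Proof.
move=> mq rho0.
transitivity (\int[mu]_(r in `[a, b])
    (\sum_(t <- index_enum T) (rho t)%:E * (\1_(q @^-1` [set t]) r)%:E))%E.
  apply: eq_integral => r _.
  rewrite (bigD1_seq (q r)) ?index_enum_uniq ?mem_index_enum//= big1 ?adde0.
    by rewrite indicE mem_set// mule1.
  by move=> t tq; rewrite indicE memNset ?mule0// => /= qt; rewrite qt eqxx in tq.
rewrite ge0_integral_sum//; first last.
- by move=> t r _; rewrite lee_fin mulr_ge0.
- by move=> t; apply: measurable_funeM; apply/measurable_EFinP; apply: measurable_indic; exact: mq.
rewrite -[RHS]sumEFin; apply: eq_bigr => t _.
rewrite ge0_integralZl//; last 2 first.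
- by apply/measurable_EFinP; apply: measurable_indic; exact: mq.
- by rewrite lee_fin.
rewrite integral_indic; [|exact: measurable_itv|exact: mq].
rewrite setIC EFinM fineK ?fin_num_itv_measure//.
by rewrite muleC.
Qed.

Lemma label_dist (T : finType) (q : R -> T) (phi psi : T -> X) (a b : R) :
  (forall t, measurable (q @^-1` [set t])) ->
  ((rnorm (simple_integral a b (phi \o q) - simple_integral a b (psi \o q)))%:E <=
  \int[mu]_(r in `[a, b]) (rnorm (phi (q r) - psi (q r)))%:E)%E.
Proof.
move=> mq; rewrite !label_integral// -sumrB.
rewrite (label_rintegral (rho := fun t => rnorm (phi t - psi t)))//; last first.
  by move=> t; exact: rnorm_ge0.
rewrite lee_fin (le_trans (rnorm_sum _ _ _))//; apply: ler_sum => t _.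
by rewrite -scalerBr rnormZ ger0_norm// fine_ge0.
Qed.

Lemma simple_label (s : R -> X) : simple_function s ->
  exists (T : finType) (q : R -> T) (phi : T -> X),
    (forall t, measurable (q @^-1` [set t])) /\ s = phi \o q.
Proof.
move=> [/finite_seqP[l sl] ms].
have sin r : s r \in l by have : [set` l] (s r) by rewrite -sl; exists r.
exists (seq_sub l), (fun r => SeqSub (sin r)), (@ssval _ l); split => //.
move=> t; rewrite (_ : _ @^-1` _ = s @^-1` [set ssval t])//.
apply/seteqP; split => [r /= <-//|r /= srt].
by apply: val_inj.
Qed.

(** Two simple functions are compared on a common partition, which the product of their label types
    provides. *)
Lemma simple_label2 (s s' : R -> X) : simple_function s -> simple_function s' ->
  exists (T : finType) (q : R -> T) (phi psi : T -> X),
    [/\ (forall t, measurable (q @^-1` [set t])), s = phi \o q & s' = psi \o q].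
Proof.
move=> /simple_label[T [q [phi [mq ->]]]] /simple_label[T' [q' [psi [mq' ->]]]].
exists (T * T')%type, (fun r => (q r, q' r)), (phi \o fst), (psi \o snd).
split => // -[t t'].
rewrite (_ : _ @^-1` _ = (q @^-1` [set t]) `&` (q' @^-1` [set t'])).
  exact: measurableI.
by apply/seteqP; split => [r [<- <-]//|r [/= -> ->]].
Qed.

Lemma simple_dist (s s' : R -> X) a b : simple_function s -> simple_function s' ->
  ((rnorm (simple_integral a b s - simple_integral a b s'))%:E <=
  \int[mu]_(r in `[a, b]) (rnorm (s r - s' r))%:E)%E.
Proof. by move=> ss /(simple_label2 ss)[T [q [phi [psi [mq -> ->]]]]]; exact: label_dist. Qed.

Lemma measurable_rnorm_simpleB (s s' : R -> X) :
  simple_function s -> simple_function s' ->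
  measurable_fun setT (fun r => rnorm (s r - s' r)).
Proof.
move=> ss /(simple_label2 ss)[T [q [phi [psi [mq -> ->]]]]].
exact: (label_measurable_fun (fun t => rnorm (phi t - psi t))).
Qed.

Lemma simple_cst (x : X) : simple_function (fun=> x).
Proof. 
apply: (@label_simple unit (fun=> tt) (fun=> x)) => t.
by rewrite (_ : _ @^-1` _ = setT)//; apply/seteqP; split => // r _; case: t.
Qed.

Lemma simple_integral0 a b : simple_integral a b (fun=> 0 : X) = 0.
Proof. 
rewrite (label_integral (q := fun=> tt) (fun=> 0 : X)) => [|t].
  by rewrite big1// => t _; rewrite scaler0.
by rewrite (_ : _ @^-1` _ = setT)//; apply/seteqP; split => // r _; case: t.
Qed.

Lemma simple_restrict (s : R -> X) c : simple_function s ->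
  simple_function (fun r => if r <= c then s r else 0).
Proof.
move=> /simple_label[T [q [phi [mq ->]]]].
pose psi t := if t is Some t' then phi t' else 0.
pose p r := if r <= c then Some (q r) else None.
rewrite (_ : (fun r => _) = psi \o p); last first.
  by apply/funext => r; rewrite /= /psi /p; case: ifP.
apply: label_simple => -[t|].
  rewrite (_ : _ @^-1` _ = `]-oo, c]%classic `&` q @^-1` [set t]).
    by apply: measurableI; [exact: measurable_itv|exact: mq].
  apply/seteqP; split => [r|r []]; rewrite /= /p in_itv/=.
    by case: ifP => // rc [].
  by move=> -> ->.
rewrite (_ : _ @^-1` _ = `]c, +oo[%classic); first exact: measurable_itv.
apply/seteqP; split => r; rewrite /= /p in_itv/= andbT ltNge; by case: ifP.
Qed.

Lemma simple_integral_restrict (s : R -> X) a c b : c <= b ->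
  simple_integral a b (fun r => if r <= c then s r else 0) =
  simple_integral a c s.
Proof.
move=> cb; apply: eq_fsbigr => x _.
(* The two preimages of 0 may differ on []c, b]], but the value 0 contributes nothing. *)
have [->|x0] := eqVneq x 0; first by rewrite !scaler0.
congr ((fine (mu _))%:C *: _); apply/seteqP; split => r [] /=; rewrite !in_itv/=.
  by move=> /andP[-> _]; case: ifPn => // _ xx; rewrite xx eqxx in x0.
by move=> /andP[-> rc] ->; rewrite rc (le_trans rc).
Qed.

End FiniteLabels.

(** * Step functions and left Riemann sums *)

Section StepFunctions.
Context (R : realType) (X : completeNormedModType R[i]).
Local Notation mu := (@lebesgue_measure R).
Implicit Types (a b r : R) (n : nat) (f : R -> X).

Definition left_continuous_at f (t : R) : Prop :=
  forall e : R, 0 < e -> exists2 d : R, 0 < d &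
    forall r, t - d < r -> r <= t -> rnorm (f r - f t) < e.

(* The node of a left Riemann sum attached to t lies to the left of t, so left continuity
   is enough for the step functions below to converge pointwise; oscillation at the right
   end b is harmless. *)
Definition bounded_left_continuous a b f : Prop :=
  (exists C : R, forall t, a <= t <= b -> rnorm (f t) <= C) /\
  forall t, a < t < b -> left_continuous_at f t.

Definition mesh a b n : R := (b - a) / n%:R.

Definition step_index a b n r : option 'I_n :=
  [pick i : 'I_n | a + i%:R * mesh a b n <= r < a + i.+1%:R * mesh a b n].

(* [None] stands for the point b; outside [a, b] the value is irrelevant. *)
Definition step_value a b n f (o : option 'I_n) : X :=
  if o is Some i then f (a + i%:R * mesh a b n) else f b.

Definition step a b n f : R -> X := step_value a b f \o @step_index a b n.

Definition riemann_sum a b n f : X :=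
  \sum_(i < n) (mesh a b n)%:C *: f (a + i%:R * mesh a b n).

Lemma mesh_ge0 a b n : a <= b -> 0 <= mesh a b n.
Proof. by move=> ab; rewrite divr_ge0// subr_ge0. Qed.

Lemma meshE a b n : (0 < n)%N -> n%:R * mesh a b n = b - a.
Proof. by move=> n0; rewrite mulrC divfK// pnatr_eq0 -lt0n. Qed.

Lemma mesh_le a b n m : a <= b -> (m <= n)%N -> (0 < n)%N ->
  a + m%:R * mesh a b n <= b.
Proof.
move=> ab mn n0; rewrite -lerBrDl -(meshE a b n0).
by rewrite ler_wpM2r ?mesh_ge0// ler_nat.
Qed.

Lemma step_indexP a b n r (i : 'I_n) : a <= b ->
  a + i%:R * mesh a b n <= r < a + i.+1%:R * mesh a b n ->
  @step_index a b n r = Some i.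
Proof.
move=> ab ir; rewrite /step_index; case: pickP => [k kr|/(_ i)]; last by rewrite ir.
congr Some; apply/val_inj/eqP; rewrite /= eqn_leq.
move: ir kr => /andP[i1 i2] /andP[k1 k2].
have h0 := mesh_ge0 n ab.
apply/andP; split; rewrite leqNgt; apply/negP => ik.
  have : i.+1%:R * mesh a b n <= k%:R * mesh a b n by rewrite ler_wpM2r// ler_nat.
  lra.
have : k.+1%:R * mesh a b n <= i%:R * mesh a b n by rewrite ler_wpM2r// ler_nat.
lra.
Qed.

Lemma step_index_preimage a b n (i : 'I_n) : a <= b ->
  @step_index a b n @^-1` [set Some i] =
  `[a + i%:R * mesh a b n, a + i.+1%:R * mesh a b n[%classic.
Proof.
move=> ab; apply/seteqP; split => r /=; rewrite in_itv/=; last exact: step_indexP.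
by rewrite /step_index; case: pickP => // k kr [<-].
Qed.

Lemma step_index_outside a b n r : a <= b -> (r < a) || (b <= r) ->
  @step_index a b n r = None.
Proof.
move=> ab rab; rewrite /step_index; case: pickP => // i /andP[ir ri].
have h0 := mesh_ge0 n ab.
have n0 : (0 < n)%N by case: n i ri ir h0 => // -[].
have h1 := mesh_le ab (ltn_ord i) n0.
have h2 : 0 <= i%:R * mesh a b n by rewrite mulr_ge0.
by exfalso; case/orP: rab; lra.
Qed.

Lemma step_index_inside a b n r : a < b -> (0 < n)%N -> a <= r < b ->
  exists2 i : 'I_n, a + i%:R * mesh a b n <= r < a + i.+1%:R * mesh a b n &
    @step_index a b n r = Some i.
Proof.
move=> ab n0 /andP[ar rb].
have h0 : 0 < mesh a b n by rewrite divr_gt0 ?subr_gt0// ltr0n.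
have q0 : 0 <= (r - a) / mesh a b n by rewrite divr_ge0 ?subr_ge0// ltW.
have /andP[k1 k2] := truncn_itv q0.
have kn : (Num.truncn ((r - a) / mesh a b n) < n)%N.
  rewrite truncn_lt_nat// ltr_pdivrMr// meshE//; lra.
have ir : a + (Ordinal kn)%:R * mesh a b n <= r < a + (Ordinal kn).+1%:R * mesh a b n.
  by move: k1 k2; rewrite /= ler_pdivlMr// ltr_pdivrMr//; lra.
by exists (Ordinal kn) => //; apply: step_indexP => //; exact: ltW.
Qed.

Lemma step_index_measurable a b n : a <= b ->
  forall o, measurable (@step_index a b n @^-1` [set o]).
Proof.
move=> ab [i|]; first by rewrite step_index_preimage//; exact: measurable_itv.
rewrite (_ : _ @^-1` _ =
    ~` \bigcup_(i in [set: 'I_n]) (@step_index a b n @^-1` [set Some i])).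
  apply: measurableC; apply: fin_bigcup_measurable => [|i _]; first exact: finite_finset.
  by rewrite step_index_preimage//; exact: measurable_itv.
apply/seteqP; split => r /= rN; first by move=> [i _ /=]; rewrite rN.
by case E : (step_index a b n r) => [i|//]; exfalso; apply: rN; exists i.
Qed.

Lemma step_simple a b n f : a <= b -> simple_function (step a b n f).
Proof. by move=> ab; apply: label_simple; exact: step_index_measurable. Qed.

Lemma step_integral a b n f : a <= b -> (0 < n)%N ->
  simple_integral a b (step a b n f) = riemann_sum a b n f.
Proof.
move=> ab n0; rewrite label_integral; last exact: step_index_measurable.
rewrite (bigD1 None)//= (reindex_omap Some id)/=; last by case.
(* The fibre of [None] meets [[a, b]] only in the point [b], which is null. *)
rewrite [X in X%:C *: f b](_ : _ = 0); last first.
  rewrite (_ : _ `&` _ = [set b]) ?lebesgue_measure_set1//.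
  apply/seteqP; split => r /=; rewrite in_itv/=.
    move=> [/andP[ar]]; rewrite le_eqVlt => /predU1P[//|rb].
    have [|i _ ->//] := @step_index_inside a b n r (le_lt_trans ar rb) n0.
    by rewrite ar.
  by move=> ->; rewrite lexx ab step_index_outside// lexx orbT.
rewrite scale0r add0r; apply: eq_big => i; first by rewrite eqxx.
move=> _; rewrite step_index_preimage//; congr (_%:C *: _).
have h0 := mesh_ge0 n ab.
have h1 := mesh_le ab (ltn_ord i) n0.
have h2 : 0 <= i%:R * mesh a b n by rewrite mulr_ge0.
rewrite (_ : _ `&` _ = `[a + i%:R * mesh a b n, a + i.+1%:R * mesh a b n[%classic).
  rewrite lebesgue_measure_itv/= lte_fin -natr1 mulrDl mul1r addrA.
  case: ltP => [_|]; first by rewrite -EFinB/=; ring.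
  by rewrite gerDl => h3; apply/le_anti; rewrite h0 h3.
apply/seteqP; split => r /=; rewrite !in_itv/=; first by case.
move=> /andP[r1 r2]; split; last by rewrite r1 r2.
by apply/andP; split; lra.
Qed.

Lemma step_cvg a b f r : bounded_left_continuous a b f -> a <= r <= b ->
  step a b n f r @[n --> \oo] --> f r.
Proof.
move=> [_ lf] /andP[ar rb].
have ab : a <= b by exact: le_trans rb.
move: rb; rewrite le_eqVlt => /predU1P[->|rb].
  rewrite (_ : (fun n => _) = fun=> f b); first exact: cvg_cst.
  by apply/funext => n; rewrite /step/= step_index_outside// lexx orbT.
have ab' : a < b by exact: le_lt_trans rb.
apply/cvg_rnormP/cvgr0Pnorm_lt => e e0.
(* No continuity is assumed at [a]; there the node is [a] itself as soon as [n > 0]. *)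
move: ar; rewrite le_eqVlt => /predU1P[ar|ar].
  exists 1%N => // n /= n0.
  have [i ir si] := step_index_inside ab' n0 (introT andP (conj (lexx a) ab')).
  rewrite -ar /step/= si/=.
  have -> : a + i%:R * mesh a b n = a.
    apply/le_anti; case/andP: ir => -> _ /=.
    by rewrite lerDl mulr_ge0// mesh_ge0.
  by rewrite subrr rnorm0 normr0.
have [d d0 fd] := lf r (introT andP (conj ar rb)) e e0.
have [N _ HN] := @cvgr0_norm_lt _ _ _ _ _ _ (@cvg_harmonic R) (d / (b - a)) (divr_gt0 d0 (ltac:(by rewrite subr_gt0) : 0 < b - a)).
exists N.+1 => // -[//|n] /= nN.
have [i /andP[i1 i2] si] := step_index_inside ab' (ltn0Sn n) (introT andP (conj (ltW ar) rb)).
rewrite /step/= si/= ger0_norm ?rnorm_ge0//; apply: fd => //.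
have := HN n nN; rewrite /harmonic/= ger0_norm// ltr_pdivlMr ?subr_gt0// => hd.
have : mesh a b n.+1 < d by rewrite /mesh mulrC.
by move: i2; rewrite -natr1 mulrDl mul1r; lra.
Qed.

End StepFunctions.

(** * Bochner integrals of bounded left-continuous functions *)

Section BochnerLeftContinuous.
Context (R : realType) (X : completeNormedModType R[i]).
Local Notation mu := (@lebesgue_measure R).
Implicit Types (a b r : R) (n : nat) (f s : R -> X).

Lemma measurable_rnormB_simple a b f s : a <= b -> bounded_left_continuous a b f ->
  simple_function s -> measurable_fun `[a, b] (fun r => rnorm (f r - s r)).
Proof.
move=> ab bf ss.
apply: (@measurable_fun_cvg _ _ _ _ (fun n r => rnorm (step a b n f r - s r))).
  move=> n; apply: measurable_funTS.
  by apply: measurable_rnorm_simpleB => //; exact: step_simple.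
move=> r; rewrite /= in_itv/= => abr; apply: cvg_rnorm.
by apply: cvgB; [exact: step_cvg|exact: cvg_cst].
Qed.

Let L1dist a b f s : \bar R := (\int[mu]_(r in `[a, b]) (rnorm (f r - s r))%:E)%E.

Lemma simple_dist_triangle a b f s s' : a <= b -> bounded_left_continuous a b f ->
  simple_function s -> simple_function s' ->
  ((rnorm (simple_integral a b s - simple_integral a b s'))%:E <=
   L1dist a b f s + L1dist a b f s')%E.
Proof.
move=> ab bf ss ss'; rewrite (le_trans (simple_dist _ _ ss ss'))//.
rewrite /L1dist -ge0_integralD//; first last.
- by apply/measurable_EFinP; exact: measurable_rnormB_simple.
- by move=> r _; rewrite lee_fin rnorm_ge0.
- by apply/measurable_EFinP; exact: measurable_rnormB_simple.
- by move=> r _; rewrite lee_fin rnorm_ge0.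
apply: ge0_le_integral => //.
- by move=> r _; rewrite lee_fin rnorm_ge0.
- by apply/measurable_EFinP/measurable_funTS; exact: measurable_rnorm_simpleB.
- by apply: emeasurable_funD; apply/measurable_EFinP; exact: measurable_rnormB_simple.
by move=> r _; rewrite -EFinD lee_fin (rdistC (f r)) rdist_tri.
Qed.

Lemma step_bound a b n f (C : R) : a <= b ->
  (forall t, a <= t <= b -> rnorm (f t) <= C) -> forall r, rnorm (step a b n f r) <= C.
Proof.
move=> ab fC r; rewrite /step/=; case: (step_index a b n r) => [i|] /=.
  have n0 : (0 < n)%N by case: n i => // -[].
  by apply: fC; rewrite lerDl mulr_ge0 ?mesh_ge0//= mesh_le// ltnW.
by apply: fC; rewrite lexx ab.
Qed.

Lemma integrable_itv_cst a b (C : R) : mu.-integrable `[a, b] (cst C%:E).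
Proof.
apply/integrableP; split; first exact: measurable_cst.
rewrite (_ : (fun x => _) = cst `|C|%:E)// integral_cst//=.
rewrite lebesgue_measure_itv/=; case: ifPn => _; rewrite ?mule0 ?ltry//.
Qed.

Lemma step_L1_cvg a b f : a <= b -> bounded_left_continuous a b f ->
  L1dist a b f (step a b n f) @[n --> \oo] --> 0%E.
Proof.
move=> ab bf; have [C fC] := bf.1.
rewrite [X in _ --> X](_ : _ = \int[mu]_(r in `[a, b]) cst 0%E r)%E; last first.
  by rewrite integral0.
have [] := @dominated_convergence _ _ _ mu `[a, b] (measurable_itv _)
  (fun n r => (rnorm (f r - step a b n f r))%:E) (cst 0%E) (cst (2 * C)%:E) => //.
- move=> n; apply/measurable_EFinP; apply: measurable_rnormB_simple => //.
  exact: step_simple.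
- apply: aeW => r; rewrite /= in_itv/= => abr.
  have /cvg_rnormP sf := step_cvg bf abr.
  apply: cvg_EFin; first exact: nearW.
  by rewrite (_ : _ \o _ = fun n => rnorm (step a b n f r - f r))//;
    apply/funext => n /=; rewrite rdistC.
- exact: integrable_itv_cst.
- apply: aeW => r n; rewrite /= in_itv/= => abr.
  rewrite lee_fin ger0_norm ?rnorm_ge0// (le_trans (rnormB _ _))//.
  by rewrite mulr2n mulrDl mul1r lerD ?fC// step_bound.
Qed.

Lemma near_lte (u : nat -> \bar R) (e : R) : u n @[n --> \oo] --> 0%E -> 0 < e ->
  \forall n \near \oo, (u n < e%:E)%E.
Proof.
move=> u0 e0; have e0' : (0%E < e%:E)%E by rewrite lte_fin.
exact: (u0 _ (open_ereal_lt' e0')).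
Qed.

Lemma simple_integral_cvg a b f (s : nat -> R -> X) : a <= b ->
  bounded_left_continuous a b f -> (forall n, simple_function (s n)) ->
  L1dist a b f (s n) @[n --> \oo] --> 0%E ->
  cvg (simple_integral a b (s n) @[n --> \oo]).
Proof.
move=> ab bf ss s0; apply: cauchy_rnorm => e e0.
have e2 : 0 < e / 2 by rewrite divr_gt0.
have [N _ HN] := near_lte s0 e2.
exists (simple_integral a b (s N)); exists N => // n /= Nn.
rewrite -lte_fin (le_lt_trans (simple_dist_triangle ab bf (ss _) (ss _)))//.
by rewrite [e]splitr EFinD lteD// HN/=.
Qed.

Lemma simple_integral_cvg_unique a b f (s s' : nat -> R -> X) (v : X) : a <= b ->
  bounded_left_continuous a b f -> (forall n, simple_function (s n)) ->
  (forall n, simple_function (s' n)) ->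
  L1dist a b f (s n) @[n --> \oo] --> 0%E -> L1dist a b f (s' n) @[n --> \oo] --> 0%E ->
  simple_integral a b (s n) @[n --> \oo] --> v ->
  simple_integral a b (s' n) @[n --> \oo] --> v.
Proof.
move=> ab bf ss ss' s0 s'0 /cvg_rnormP/cvgr0Pnorm_lt sv.
apply/cvg_rnormP/cvgr0Pnorm_lt => e e0.
have e4 : 0 < e / 4 by rewrite divr_gt0.
near=> n; rewrite ger0_norm ?rnorm_ge0//.
apply: (le_lt_trans (rdist_tri (simple_integral a b (s n)) _ _)).
have : rnorm (simple_integral a b (s n) - v) < e / 4.
  by rewrite -[X in X < _]ger0_norm ?rnorm_ge0//; near: n; exact: sv.
suff : rnorm (simple_integral a b (s' n) - simple_integral a b (s n)) < e / 4 + e / 4 by lra.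
rewrite -lte_fin (le_lt_trans (simple_dist_triangle ab bf (ss' n) (ss n)))//.
by rewrite EFinD lteD//; near: n; exact: near_lte.
Unshelve. all: by end_near. Qed.

Lemma is_bochner_integral_step a b f : a <= b -> bounded_left_continuous a b f ->
  is_bochner_integral a b f (lim (simple_integral a b (step a b n f) @[n --> \oo])).
Proof.
move=> ab bf; have ss n : simple_function (step a b n f) by exact: step_simple.
split.
  exists (fun n => step a b n f) => //.
  by apply: aeW => r /=; rewrite in_itv/=; exact: step_cvg.
exists (fun n => step a b n f); split => //; first exact: step_L1_cvg.
apply: (@simple_integral_cvg a b f) => //; exact: step_L1_cvg.
Qed.

Lemma bochner_integralP a b f : a <= b -> bounded_left_continuous a b f ->
  is_bochner_integral a b f (bochner_integral a b f).
Proof. by move=> ab bf; apply: xgetPex; eexists; exact: is_bochner_integral_step. Qed.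

Lemma is_bochner_integral_cvg a b f (v : X) (s : nat -> R -> X) : a <= b ->
  bounded_left_continuous a b f -> is_bochner_integral a b f v ->
  (forall n, simple_function (s n)) -> L1dist a b f (s n) @[n --> \oo] --> 0%E ->
  simple_integral a b (s n) @[n --> \oo] --> v.
Proof.
move=> ab bf [_ [s' [ss' s'0 s'v]]] ss s0.
exact: (simple_integral_cvg_unique ab bf ss' ss).
Qed.

Lemma is_bochner_integral_unique a b f v : a <= b -> bounded_left_continuous a b f ->
  is_bochner_integral a b f v -> bochner_integral a b f = v.
Proof.
move=> ab bf fv; have ss n : simple_function (step a b n f) by exact: step_simple.
have s0 := step_L1_cvg ab bf.
have h1 := is_bochner_integral_cvg ab bf fv ss s0.
have h2 := is_bochner_integral_cvg ab bf (bochner_integralP ab bf) ss s0.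
exact: (norm_cvg_unique h2 h1).
Qed.

Lemma riemann_sum_cvg a b f : a <= b -> bounded_left_continuous a b f ->
  riemann_sum a b n f @[n --> \oo] --> bochner_integral a b f.
Proof.
move=> ab bf; have ss n : simple_function (step a b n f) by exact: step_simple.
have := is_bochner_integral_cvg ab bf (bochner_integralP ab bf) ss (step_L1_cvg ab bf).
apply: cvg_trans; apply: near_eq_cvg; exists 1%N => // n /= n0.
by rewrite step_integral.
Qed.

(** A majorant [psi] that is a function, not a constant, lets a small set where [f] is large be
    charged separately. The bound is first proved for the step approximations, up to their L1
    distance from [f]. *)
Lemma rnorm_bochner_integral_le a b f (psi : R -> R) : a <= b ->
  bounded_left_continuous a b f -> measurable_fun setT psi ->
  (forall t, a <= t <= b -> rnorm (f t) <= psi t) ->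
  ((rnorm (bochner_integral a b f))%:E <= \int[mu]_(t in `[a, b]) (psi t)%:E)%E.
Proof.
move=> ab bf mpsi fpsi.
have ss n : simple_function (step a b n f) by exact: step_simple.
have s0 := step_L1_cvg ab bf.
have sv := is_bochner_integral_cvg ab bf (bochner_integralP ab bf) ss s0.
have psi0 r : `[a, b]%classic r -> 0 <= psi r.
  by rewrite /= in_itv/= => /fpsi; apply: le_trans; exact: rnorm_ge0.
have key n : ((rnorm (simple_integral a b (step a b n f)))%:E <=
    L1dist a b f (step a b n f) + \int[mu]_(t in `[a, b]) (psi t)%:E)%E.
  have := simple_dist a b (ss n) (simple_cst 0).
  rewrite simple_integral0 subr0 => /le_trans; apply.
  rewrite /L1dist -ge0_integralD//; first last.
  - by apply/measurable_EFinP; exact: measurable_funTS.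
  - by apply/measurable_EFinP; exact: measurable_rnormB_simple.
  - by move=> r _; rewrite lee_fin rnorm_ge0.
  apply: ge0_le_integral => //.
  - by move=> r _; rewrite lee_fin rnorm_ge0.
  - apply/measurable_EFinP/measurable_funTS.
    by apply: measurable_rnorm_simpleB => //; exact: simple_cst.
  - by apply: emeasurable_funD; apply/measurable_EFinP;
      [exact: measurable_rnormB_simple|exact: measurable_funTS].
  move=> r; rewrite /= in_itv/= => /fpsi fr.
  rewrite -EFinD lee_fin subr0.
  have := rdist_tri (f r) (step a b n f r) 0; rewrite !subr0 (rdistC (step _ _ _ _ _)).
  lra.
have J0 : (0 <= \int[mu]_(t in `[a, b]) (psi t)%:E)%E.
  by apply: integral_ge0 => r /psi0; rewrite lee_fin.
move: J0 key; case: (\int[mu]_(t in `[a, b]) (psi t)%:E)%E => [J| |]//; last by move=> _ _; rewrite leey.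
move=> _ key; rewrite lee_fin; apply/ler_addgt0Pl => e e0.
apply: (rnorm_lim_le sv); apply: filterS (near_lte s0 e0) => n ne.
by rewrite -lee_fin (le_trans (key n))// EFinD leeD2r// ltW.
Qed.

End BochnerLeftContinuous.

(** * Operations on Bochner integrals and norm estimates *)

Section BochnerOperations.
Context (R : realType) (X : completeNormedModType R[i]).
Local Notation mu := (@lebesgue_measure R).
Implicit Types (a b c d : R) (f g : R -> X).

Lemma blc_eq a b f g : (forall t, a <= t <= b -> f t = g t) ->
  bounded_left_continuous a b f -> bounded_left_continuous a b g.
Proof.
move=> fg [[C fC] lf]; split; first by exists C => t abt; rewrite -fg// fC.
move=> t /[dup] /andP[ta tb] /lf H e /H[d d0 Hd].
(* The radius is cut so that the left neighbourhood of [t] stays in [[a, b]], where [f] and [g]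
   agree. *)
exists (Num.min d (t - a)); first by rewrite lt_min d0 subr_gt0.
move=> r; rewrite ltrBlDr -ltrBlDl lt_min => /andP[r1 r2] rt.
rewrite -!fg; first by apply: Hd => //; lra.
- by rewrite !ltW.
- by apply/andP; split; lra.
Qed.

Lemma bochner_integral_eq a b f g : a <= b -> bounded_left_continuous a b f ->
  (forall t, a <= t <= b -> f t = g t) -> bochner_integral a b f = bochner_integral a b g.
Proof.
move=> ab bf fg; have bg := blc_eq fg bf.
apply: (norm_cvg_unique (riemann_sum_cvg ab bf)) => /=.
have := riemann_sum_cvg ab bg; apply: cvg_trans; apply: near_eq_cvg.
exists 1%N => // n /= n0; apply: eq_bigr => i _; rewrite fg//.
by rewrite lerDl mulr_ge0 ?mesh_ge0//= mesh_le// ltnW.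
Qed.

Lemma blcB a b f g : bounded_left_continuous a b f -> bounded_left_continuous a b g ->
  bounded_left_continuous a b (fun t => f t - g t).
Proof.
move=> [[C fC] lf] [[D gD] lg]; split.
  by exists (C + D) => t abt; rewrite (le_trans (rnormB _ _))// lerD ?fC ?gD.
move=> t abt e e0; have e2 : 0 < e / 2 by rewrite divr_gt0.
have [d1 d10 H1] := lf t abt _ e2; have [d2 d20 H2] := lg t abt _ e2.
exists (Num.min d1 d2); first by rewrite lt_min d10.
move=> r; rewrite ltrBlDr -ltrBlDl lt_min => /andP[r1 r2] rt.
rewrite (_ : _ - _ = (f r - f t) - (g r - g t)); last first.
  by rewrite !opprB addrACA [RHS]addrACA; congr (_ + _); rewrite addrC.
rewrite (le_lt_trans (rnormB _ _))// [e]splitr ltrD//; first by apply: H1 => //; lra.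
by apply: H2 => //; lra.
Qed.

Lemma bochner_integralB a b f g : a <= b -> bounded_left_continuous a b f ->
  bounded_left_continuous a b g ->
  bochner_integral a b (fun t => f t - g t) =
  bochner_integral a b f - bochner_integral a b g.
Proof.
move=> ab bf bg; apply: (norm_cvg_unique (riemann_sum_cvg ab (blcB bf bg))) => /=.
rewrite (_ : (fun n => _) = (fun n => riemann_sum a b n f - riemann_sum a b n g)).
  by apply: cvgB; exact: riemann_sum_cvg.
by apply/funext => n; rewrite -sumrB; apply: eq_bigr => i _; rewrite scalerBr.
Qed.

Lemma rnorm_bochner_integral_bound a b f (C : R) : a <= b ->
  bounded_left_continuous a b f -> (forall t, a <= t <= b -> rnorm (f t) <= C) ->
  rnorm (bochner_integral a b f) <= C * (b - a).
Proof.
move=> ab bf fC.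
have := @rnorm_bochner_integral_le _ _ a b f (cst C) ab bf (measurable_cst _) fC.
rewrite (_ : (fun x => _) = cst C%:E)// integral_cst//= lebesgue_measure_itv/= lte_fin.
case: ltP => [_|ba]; first by rewrite -EFinB -EFinM lee_fin.
by rewrite mule0 lee_fin (le_anti (introT andP (conj ab ba))) subrr mulr0.
Qed.

Lemma rnorm_bochner_integral_bound_off a b (E : set R) (m : R) f (C D : R) : a <= b ->
  measurable E -> (mu E <= m%:E)%E ->
  0 <= C -> 0 <= D -> bounded_left_continuous a b f ->
  (forall t, a <= t <= b -> rnorm (f t) <= C) ->
  (forall t, a <= t <= b -> ~ E t -> rnorm (f t) <= D) ->
  rnorm (bochner_integral a b f) <= C * m + D * (b - a).
Proof.
move=> ab mE Em C0 D0 bf fC fD.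
pose psi t : R := C * \1_E t + D.
have mpsi : measurable_fun setT psi.
  by apply: measurable_funD => //; apply: measurable_funM.
have fpsi t : a <= t <= b -> rnorm (f t) <= psi t.
  move=> abt; rewrite /psi indicE; case: (boolP (t \in _)) => [|tE].
    by rewrite mulr1 (le_trans (fC _ abt))// lerDl.
  by rewrite mulr0 add0r fD//; move: tE; rewrite notin_setE.
have := rnorm_bochner_integral_le ab bf mpsi fpsi.
rewrite -lee_fin => /le_trans; apply.
rewrite (_ : (fun x => _) = (fun x => C%:E * (\1_E x)%:E + cst D%:E x)%E)//.
rewrite ge0_integralD//; first last.
- by apply: measurable_funeM; apply/measurable_EFinP; exact: measurable_indic.
- by move=> r _; rewrite -EFinM lee_fin mulr_ge0.
rewrite integral_cst// ge0_integralZl//; last first.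
  by apply/measurable_EFinP; exact: measurable_indic.
rewrite integral_indic//; rewrite EFinD; apply: leeD.
  rewrite EFinM lee_wpmul2l// (le_trans _ Em)//.
  by apply: le_measure; rewrite ?inE//; apply: measurableI => //; exact: measurable_itv.
rewrite /= lebesgue_measure_itv/= lte_fin; case: ifPn => // _.
by rewrite mule0 lee_fin mulr_ge0// subr_ge0.
Qed.

Lemma measure_itv_le c d : c <= d -> (mu `[c, d]%classic <= (d - c)%:E)%E.
Proof.
move=> cd; rewrite lebesgue_measure_itv/= lte_fin; case: ifPn => // _.
by rewrite lee_fin subr_ge0.
Qed.

(** Riemann sums over [[a, b]] and over [[a, c]] have unrelated nodes, so the approximating simple
    functions themselves are cut off at [c]. *)
Lemma is_bochner_integral_extend a b c f v : c <= b ->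
  (forall t, c < t <= b -> f t = 0) ->
  is_bochner_integral a c f v -> is_bochner_integral a b f v.
Proof.
move=> cb f0 [[s ss sf] [s' [ss' s'0 s'v]]]; split.
  exists (fun n r => if r <= c then s n r else 0) => [n|]; first exact: simple_restrict.
  have [N [mN N0 subN]] := sf; exists N; split => //; apply: subset_trans subN.
  move=> t /= tN tf; apply: tN; rewrite in_itv/= => /andP[at_ tb].
  case: (leP t c) => tc; first by apply: tf; rewrite /= in_itv/= at_.
  by rewrite f0 ?tc//; exact: cvg_cst.
exists (fun n r => if r <= c then s' n r else 0); split.
- by move=> n; exact: simple_restrict.
- apply: cvg_trans s'0; apply: near_eq_cvg; apply: nearW => n.
  rewrite integral_mkcond [RHS]integral_mkcond; apply: eq_integral => r _.
  rewrite /patch; have [rc|cr] := leP r c.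
    rewrite (_ : (r \in `[a, b]%classic) = (r \in `[a, c]%classic))//.
    apply/idP/idP; rewrite !inE/= !in_itv/= rc => /andP[-> //= _].
    by rewrite (le_trans rc).
  rewrite memNset/=; last by rewrite in_itv/= [r <= c]leNgt cr andbF.
  case: ifPn => //; rewrite inE/= in_itv/= => /andP[_ rb].
  by rewrite f0 ?cr// subr0 rnorm0.
by under eq_fun do rewrite simple_integral_restrict//.
Qed.

Lemma bochner_integral_extend a b c f : a <= c -> c <= b ->
  bounded_left_continuous a b f -> (forall t, c < t <= b -> f t = 0) ->
  bochner_integral a b f = bochner_integral a c f.
Proof.
move=> ac cb bf f0; apply: is_bochner_integral_unique => //; first exact: le_trans cb.
apply: (is_bochner_integral_extend cb f0); apply: bochner_integralP => //.
have [[C fC] lf] := bf; split.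
  by exists C => t /andP[at_ tc]; rewrite fC// at_ (le_trans tc).
by move=> t /andP[at_ tc]; apply: lf; rewrite at_ (lt_le_trans tc).
Qed.

End BochnerOperations.

Section BochnerBoundedLinear.
Context (R : realType) (X Y : completeNormedModType R[i]) (B : X -> Y).
Hypothesis bB : bounded_linear B.
Implicit Types (a b : R) (f : R -> X).

Lemma blc_blin a b f : bounded_left_continuous a b f ->
  bounded_left_continuous a b (B \o f).
Proof.
have [M M1 HM] := blin_bound bB; have M0 : 0 < M by exact: lt_le_trans M1.
move=> [[C fC] lf]; split.
  by exists (M * C) => t abt; rewrite (le_trans (HM _))// ler_pM2l// fC.
move=> t abt e e0; have [d d0 Hd] := lf t abt (e / M) (divr_gt0 e0 M0).
exists d => // r r1 r2; rewrite /= -blinB// (le_lt_trans (HM _))//.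
by rewrite mulrC -ltr_pdivlMr// Hd.
Qed.

Lemma bochner_integral_blin a b f : a <= b -> bounded_left_continuous a b f ->
  bochner_integral a b (B \o f) = B (bochner_integral a b f).
Proof.
move=> ab bf; apply: (norm_cvg_unique (riemann_sum_cvg ab (blc_blin bf))) => /=.
rewrite (_ : (fun n => _) = (fun n => B (riemann_sum a b n f))).
  by apply: blin_cvg => //; exact: riemann_sum_cvg.
apply/funext => n; rewrite blin_sum//; apply: eq_bigr => i _.
by rewrite blinZ.
Qed.

End BochnerBoundedLinear.

(** * Uniform boundedness *)

(** For inductive constructions in which a next state exists only from states satisfying an
    invariant. The implication under [choice] makes the relation total, with [x0] as a default
    successor of the other states. *)
Lemma invariant_dependent_choice (T : Type) (Q : T -> Prop) (r : T -> T -> Prop) x0 :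
  Q x0 -> (forall x, Q x -> exists2 y, Q y & r x y) ->
  exists f : nat -> T, [/\ f 0%N = x0, forall n, Q (f n) & forall n, r (f n) (f n.+1)].
Proof.
move=> Qx0 H.
have [x|g gP] := @choice _ _ (fun x y => Q x -> Q y /\ r x y).
  case: (pselect (Q x)) => [/H[y Qy xy]|nQ]; first by exists y.
  by exists x0 => /nQ.
have Qf n : Q (iter n g x0) by elim: n => //= n /gP[].
by exists (fun n => iter n g x0); split => // n; have [] := gP _ (Qf n).
Qed.

Section GeometricSteps.
Context (R : realType) (V : normedModType R[i]) (x : nat -> V) (d : nat -> R).
Hypothesis d_ge0 : forall n, 0 <= d n.
Hypothesis d_half : forall n, d n.+1 <= d n / 2.
Hypothesis xd : forall n, rnorm (x n.+1 - x n) <= d n.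

Lemma geometric_steps n m : (n <= m)%N -> rnorm (x m - x n) <= 2 * d n.
Proof.
move=> /subnK <-; set k := (m - n)%N.
(* The subtracted term makes the induction close, because [d] at least halves at each step. *)
have : rnorm (x (k + n)%N - x n) <= 2 * d n - 2 * d (k + n)%N.
  elim: k => [|k IH]; first by rewrite !add0n !subrr rnorm0.
  have := rdist_tri (x (k + n)%N) (x (k.+1 + n)%N) (x n).
  have := xd (k + n); have := d_half (k + n); rewrite -!addSn; lra.
by have := d_ge0 (k + n); lra.
Qed.

Lemma geometric_steps_le n m : (n <= m)%N -> d m <= d n.
Proof.
elim: m => [|m IH]; first by rewrite leqn0 => /eqP ->.
rewrite leq_eqVlt => /predU1P[->//|/IH].
by have := d_half m; have := d_ge0 m; lra.
Qed.

Lemma geometric_steps_cvg0 : d n @[n --> \oo] --> (0 : R).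
Proof.
have dn n : d n <= d 0%N / 2 ^+ n.
  elim: n => [|n IH]; first by rewrite expr0 divr1.
  rewrite (le_trans (d_half n))// exprS invfM mulrA [X in _ <= X]mulrAC.
  by rewrite ler_pM2r ?invr_gt0.
apply: (@squeeze_cvgr _ _ _ _ (cst 0) (fun n => d 0%N / 2 ^+ n)).
- by apply: nearW => n; rewrite d_ge0 dn.
- exact: cvg_cst.
- by under eq_fun do rewrite -exprVn; apply: cvg_geometric; rewrite gtr0_norm; lra.
Qed.

Lemma geometric_steps_lim n l : x k @[k --> \oo] --> l -> rnorm (l - x n) <= 2 * d n.
Proof.
move=> xl; have : x k - x n @[k --> \oo] --> l - x n by apply: cvgB => //; exact: cvg_cst.
move=> /rnorm_lim_le; apply; near=> k; apply: geometric_steps.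
by near: k; exact: nbhs_infty_ge.
Unshelve. all: by end_near. Qed.

End GeometricSteps.

Lemma geometric_steps_cvg (R : realType) (X : completeNormedModType R[i])
    (x : nat -> X) (d : nat -> R) :
  (forall n, 0 <= d n) -> (forall n, d n.+1 <= d n / 2) ->
  (forall n, rnorm (x n.+1 - x n) <= d n) -> cvg (x n @[n --> \oo]).
Proof.
move=> d0 dh xd; apply: (@cauchy_seq_rnorm _ _ _ (fun n => 2 * d n)).
  by move=> n m; exact: geometric_steps.
rewrite -[X in _ --> X](mulr0 2); apply: cvgM; first exact: cvg_cst.
exact: geometric_steps_cvg0.
Qed.

Section UniformBoundedness.
Context (R : realType) (X : completeNormedModType R[i]) (Y : normedModType R[i]).

(** From [T (x0 + xi) - T (x0 - xi) = 2 T xi], one of the points [x0 + xi], [x0 - xi] has an image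
    at least as long as [T xi]. This replaces the category argument in the uniform boundedness
    principle. *)
Lemma not_bounded_witness (T : X -> Y) (r K M : R) : bounded_linear T -> 0 < r -> 0 < M ->
  K <= M * r -> forall x0, (exists x, M * rnorm x < rnorm (T x)) ->
  exists2 x, rnorm (x - x0) <= r & K <= rnorm (T x).
Proof.
move=> bT r0 M0 KMr x0 [x Mx].
have nx : 0 < rnorm x.
  rewrite lt_neqAle rnorm_ge0 andbT; apply/eqP => /esym /rnorm_eq0 x00.
  by move: Mx; rewrite x00 (blin0 bT) !rnorm0 mulr0 ltxx.
pose xi := (r / rnorm x)%:C *: x.
have nxi : rnorm xi = r by rewrite rnormZ ger0_norm; [rewrite divfK// gt_eqF|rewrite divr_ge0// ltW].
have Txi : M * r <= rnorm (T xi).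
  rewrite blinZ// rnormZ ger0_norm; last by rewrite divr_ge0// ltW.
  by rewrite mulrAC ler_pdivlMr// mulrAC (mulrC r) ler_pM2r// ltW.
have : 2 * K <= rnorm (T (x0 + xi)) + rnorm (T (x0 - xi)).
  have := rnormB (T (x0 + xi)) (T (x0 - xi)).
  rewrite -blinB// (_ : x0 + xi - (x0 - xi) = xi + xi); last first.
    by rewrite opprB addrA addrAC (addrC x0) addrK.
  rewrite blinD// -mulr2n -scaler_nat -(rmorph_nat (real_complex R)) rnormZ ger0_norm//.
  lra.
move=> H; have [h|h] := leP K (rnorm (T (x0 + xi))).
  by exists (x0 + xi) => //; rewrite addrC addKr nxi.
by exists (x0 - xi); [rewrite addrC addKr rnormN nxi|lra].
Qed.

(** Without a uniform bound, there is a Cauchy sequence of points at which successively chosen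
    operators reach norm [n]. The later steps are too short to change the value of the operator
    chosen at stage [n] by more than 1, so the limit point contradicts pointwise boundedness. *)
Lemma uniform_boundedness (I : Type) (T : I -> X -> Y) :
  (forall i, bounded_linear (T i)) ->
  (forall x, exists C : R, forall i, rnorm (T i x) <= C) ->
  exists2 M : R, 1 <= M & forall i x, rnorm (T i x) <= M * rnorm x.
Proof.
move=> bT pb; apply: contrapT => nM.
have unb (M : R) : 1 <= M -> exists i x, M * rnorm x < rnorm (T i x).
  move=> M1; apply: contrapT => H; apply: nM; exists M => // i x.
  by rewrite leNgt; apply/negP => h; apply: H; exists i, x.
have [i0 _] := unb 1 (lexx _).
(* A state is (x, d, i, k): the current point, the length allowed for the next
   steps, the last operator used and a lower bound of its norm at x. *)
pose st : Type := (X * R * I * nat)%type.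
pose Q (s : st) := 0 < s.1.1.2.
pose r (s s' : st) := [/\ s'.2 = s.2.+1, s'.1.1.2 <= s.1.1.2 / 2,
  rnorm (s'.1.1.1 - s.1.1.1) <= s.1.1.2, s'.2%:R <= rnorm (T s'.1.2 s'.1.1.1) &
  forall y, rnorm y <= 2 * s'.1.1.2 -> rnorm (T s'.1.2 y) <= 1].
have [|[[[x d] i] k] /= d0|f [_ fQ fr]] :=
  @invariant_dependent_choice st Q r (0, 1, i0, 0%N); rewrite /Q/= //.
  (* [M * d >= k.+1] forces a value of norm [k.+1] within distance [d] of [x], and [M >= 1] is what
     [unb] asks for. *)
  set M : R := k.+1%:R / d + 1.
  have M1 : 1 <= M by rewrite lerDr divr_ge0// ltW.
  have [j Tj] := unb M M1.
  have [y yx Ky] : exists2 y, rnorm (y - x) <= d & k.+1%:R <= rnorm (T j y).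
    apply: (not_bounded_witness (bT j) d0 (lt_le_trans ltr01 M1)) => //.
    by rewrite /M mulrDl mul1r divfK ?gt_eqF// lerDl ltW.
  have [N N1 TN] := blin_bound (bT j).
  have N0 : 0 < N by exact: lt_le_trans N1.
  (* [d / 2] keeps the steps geometric; [N^-1 / 2] makes [T j] at most 1 on the ball of twice that
     radius, which contains all later displacements. *)
  exists (y, Num.min (d / 2) (N^-1 / 2), j, k.+1).
    by rewrite /= lt_min !divr_gt0// invr_gt0.
  split => //=; first by rewrite ge_min lexx.
  move=> z; rewrite -ler_pdivrMl// le_min => /andP[_ h].
  rewrite (le_trans (TN z))// -ler_pdivlMl// mulr1; move: h; lra.
pose x n := (f n).1.1.1; pose d n := (f n).1.1.2.
have dh n : d n.+1 <= d n / 2 by have [] := fr n.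
have d0 n : 0 <= d n by apply: ltW; exact: fQ.
have xd n : rnorm (x n.+1 - x n) <= d n by have [] := fr n.
have /cvg_ex[l xl] := geometric_steps_cvg d0 dh xd.
have fk n : (n <= (f n).2)%N by elim: n => // n IH; have [-> _ _ _ _] := fr n.
have [C Cl] := pb l.
pose n := (Num.truncn (C + 1)).+1.
have := Cl (f n.+1).1.2.
have [_ _ _ h1 h2] := fr n.
have := h2 (l - x n.+1) (geometric_steps_lim d0 dh xd n.+1 xl).
have nb : C + 1 < n%:R by rewrite /n; exact: Num.Theory.truncnS_gt.
have := rdist_tri (T (f n.+1).1.2 l) (T (f n.+1).1.2 (x n.+1)) 0.
rewrite !subr0 rdistC -blinB//.
have : n.+1%:R <= (f n.+1).2%:R :> R by rewrite ler_nat.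
by rewrite -natr1; move: h1; rewrite -/(x n.+1); lra.
Qed.


End UniformBoundedness.

(** * Semigroups and their generators *)

Lemma within_continuous_rnormP (R : realType) (V : normedModType R[i]) (A : set R)
    (f : R -> V) :
  {within A, continuous f} <-> forall t, A t -> forall e : R, 0 < e ->
    exists2 d : R, 0 < d & forall s, A s -> `|s - t| < d -> rnorm (f s - f t) < e.
Proof.
rewrite subspace_continuousP; split => H t At.
  move=> e e0; have /cvg_rnormP/cvgr0Pnorm_lt/(_ e e0) := H t At.
  rewrite near_withinE => /nbhs_ballP[d /= d0 Hd].
  exists d => // s As st; have := Hd s; rewrite /ball/= distrC st => /(_ isT As).
  by rewrite ger0_norm ?rnorm_ge0.
apply/cvg_rnormP/cvgr0Pnorm_lt => e e0; have [d d0 Hd] := H t At e e0.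
rewrite near_withinE; apply/nbhs_ballP; exists d => // s; rewrite /ball/= => st As.
by rewrite ger0_norm ?rnorm_ge0// Hd// distrC.
Qed.

Lemma subr_telescope (V : zmodType) (a b z p q : V) :
  a - z - (p + q) = (b - z - p) + (a - b - q).
Proof.
rewrite opprD !addrA; congr (_ - q).
by rewrite -[b - z - p]addrA -[b + _ + a]addrA [RHS]addrAC subrr add0r [RHS]addrC addrA.
Qed.

Section Semigroup.
Context (R : realType) (X : completeNormedModType R[i]) (S : c0semigroup X).
Implicit Types (x y z w : X) (h t r : R).
Local Notation dq := (diff_quotient S).

Lemma sg_continuous_rnorm x t (e : R) : 0 <= t -> 0 < e -> exists2 d : R, 0 < d &
  forall s, 0 <= s -> `|s - t| < d -> rnorm (S s x - S t x) < e.
Proof.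
move=> t0 e0; have /within_continuous_rnormP/(_ t) := @sg_continuous _ _ S x.
rewrite /= in_itv/= andbT => /(_ t0 e e0)[d d0 Hd]; exists d => // s s0.
by apply: Hd; rewrite /= in_itv/= andbT.
Qed.

(** Orbits are continuous, hence bounded on the compact interval; uniform boundedness makes the
    bound independent of the orbit. *)
Lemma sg_bounded_on (tau : R) : exists2 M : R, 1 <= M &
  forall t x, 0 <= t <= tau -> rnorm (S t x) <= M * rnorm x.
Proof.
have [tau0|tau0] := ltP tau 0.
  by exists 1 => // t x /andP[t0 tt]; have := le_lt_trans t0 (le_lt_trans tt tau0); rewrite ltxx.
pose I := {t : R | 0 <= t <= tau}.
have [|x|M M1 HM] := @uniform_boundedness _ X X I (fun i => S (sval i)).
- by move=> [t /= /andP[t0 _]]; exact: sg_bounded.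
- have [|c _ Hc] := @EVT_max R (fun t => rnorm (S t x)) 0 tau tau0.
    apply/subspace_continuousP => t t0.
    apply: (@cvg_rnorm R X).
    have : {within `[0, tau], continuous (fun t => S t x)}.
      apply: continuous_subspaceW (@sg_continuous _ _ S x).
      by move=> s /=; rewrite !in_itv/= andbT => /andP[].
    by move/subspace_continuousP; exact.
  by exists (rnorm (S c x)) => -[t /= tt]; apply: Hc; rewrite in_itv.
by exists M => // t x tt; exact: (HM (exist _ t tt)).
Qed.

Lemma gen_domE x : gen_dom S x -> dq x h @[h --> 0^'+] --> gen S x.
Proof. by []. Qed.

Lemma gen_cvg x y : dq x h @[h --> 0^'+] --> y -> gen_dom S x /\ gen S x = y.
Proof. by move=> xy; split; [exact: cvgP xy|exact: cvg_lim xy]. Qed.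

Lemma gen_domP x y : gen_dom S x -> gen S x = y -> dq x h @[h --> 0^'+] --> y.
Proof. by move=> Dx <-; exact: gen_domE. Qed.

Lemma diff_quotientZD (c : R[i]) x y h : 0 <= h ->
  dq (c *: x + y) h = c *: dq x h + dq y h.
Proof.
move=> h0; have bS := sg_bounded S h0; rewrite /diff_quotient.
rewrite (blinD bS) (blinZ bS) scalerA mulrC -scalerA -scalerDr; congr (_ *: _).
by rewrite scalerBr opprD addrACA.
Qed.

Lemma diff_quotientB x y h : 0 <= h -> dq (x - y) h = dq x h - dq y h.
Proof.
by move=> h0; rewrite [x - y]addrC -scaleN1r diff_quotientZD// scaleN1r addrC.
Qed.

Lemma gen_linear (c : R[i]) x y : gen_dom S x -> gen_dom S y ->
  gen_dom S (c *: x + y) /\ gen S (c *: x + y) = c *: gen S x + gen S y.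
Proof.
move=> Dx Dy; apply: gen_cvg.
have : c *: dq x h + dq y h @[h --> 0^'+] --> c *: gen S x + gen S y.
  by apply: cvgD; [apply: cvgZr|]; exact: gen_domE.
apply: cvg_trans; apply: near_eq_cvg; near=> h.
by rewrite diff_quotientZD//; near: h; exact: nbhs_right_ge.
Unshelve. all: by end_near. Qed.

Lemma gen0 : gen_dom S 0 /\ gen S 0 = 0.
Proof.
apply: gen_cvg; apply: (@cvg_trans _ (cst 0 h @[h --> 0^'+])); last exact: cvg_cst.
apply: near_eq_cvg; near=> h.
rewrite /diff_quotient blin0 ?subrr ?scaler0//; apply: sg_bounded.
by near: h; exact: nbhs_right_ge.
Unshelve. all: by end_near. Qed.

Lemma genZ (c : R[i]) x : gen_dom S x ->
  gen_dom S (c *: x) /\ gen S (c *: x) = c *: gen S x.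
Proof. by move=> Dx; have := gen_linear c Dx gen0.1; rewrite gen0.2 !addr0. Qed.

Lemma genD x y : gen_dom S x -> gen_dom S y ->
  gen_dom S (x + y) /\ gen S (x + y) = gen S x + gen S y.
Proof. by move=> Dx Dy; have := gen_linear 1 Dx Dy; rewrite !scale1r. Qed.

Lemma genB x y : gen_dom S x -> gen_dom S y ->
  gen_dom S (x - y) /\ gen S (x - y) = gen S x - gen S y.
Proof.
by move=> Dx Dy; have := gen_linear (-1) Dy Dx; rewrite !scaleN1r ![- _ + _]addrC.
Qed.

Lemma gen_sg t x : 0 <= t -> gen_dom S x ->
  gen_dom S (S t x) /\ gen S (S t x) = S t (gen S x).
Proof.
move=> t0 Dx; apply: gen_cvg; have bS := sg_bounded S t0.
have : S t (dq x h) @[h --> 0^'+] --> S t (gen S x).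
  by apply: blin_cvg => //; exact: gen_domE.
apply: cvg_trans; apply: near_eq_cvg; near=> h.
have h0 : 0 <= h by near: h; exact: nbhs_right_ge.
by rewrite /diff_quotient (blinZ bS) (blinB bS) -!sgD// [h + t]addrC.
Unshelve. all: by end_near. Qed.

Lemma gen_rnorm x (e : R) : gen_dom S x -> 0 < e -> exists2 d : R, 0 < d &
  forall h, 0 < h -> h < d -> rnorm (dq x h - gen S x) < e.
Proof.
move=> /gen_domE/cvg_rnormP/cvgr0Pnorm_lt xg e0; have := xg e e0.
rewrite near_withinE => /nbhs_ballP[d /= d0 Hd].
exists d => // h h0 hd; have := Hd h; rewrite /ball/= sub0r normrN gtr0_norm// hd.
by move=> /(_ isT h0); rewrite ger0_norm ?rnorm_ge0.
Qed.

Lemma diff_quotientE x h : 0 < h -> S h x - x = h%:C *: dq x h.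
Proof.
move=> h0; rewrite /diff_quotient scalerA -rmorphM/= divff ?gt_eqF//.
by rewrite scale1r.
Qed.

(* Telescoping of S(t) z - z over a mesh h = t / n, where S(h) z - z is h A z up to o(h). *)
Lemma sg_mean_value z (q : X) t (c : R) : gen_dom S z -> 0 <= t -> 0 <= c ->
  (forall r, 0 <= r <= t -> rnorm (S r (gen S z) - q) <= c) ->
  rnorm (S t z - z - t%:C *: q) <= t * c.
Proof.
move=> Dz; rewrite le_eqVlt => /predU1P[<- _ _|t0 c0 Hc].
  by rewrite sg0 subrr scale0r subrr rnorm0 mul0r.
have [M M1 HM] := sg_bounded_on t.
have M0 : 0 < M by exact: lt_le_trans M1.
apply/ler_addgt0Pr => e e0.
(* Each of the [n] cells contributes [h * M * (e / (t * M))], which adds up to [e]. *)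
have e1 : 0 < e / (t * M) by rewrite divr_gt0// mulr_gt0.
have [d d0 Hd] := gen_rnorm Dz e1.
pose n := (Num.truncn (t / d)).+1; pose h := t / n%:R.
have n0 : (0 : R) < n%:R by rewrite ltr0n.
have h0 : 0 < h by rewrite divr_gt0.
have nh : n%:R * h = t by rewrite mulrC divfK// gt_eqF.
have hd : h < d.
  by rewrite ltr_pdivrMr// mulrC -ltr_pdivrMr//; exact: Num.Theory.truncnS_gt.
clearbody h; clearbody n.
have key k : (k <= n)%N ->
    rnorm (S (k%:R * h) z - z - (k%:R * h)%:C *: q) <= k%:R * (h * (e / t + c)).
  elim: k => [_|k IH kn]; first by rewrite !mul0r sg0 subrr scale0r subrr rnorm0.
  have kh0 : 0 <= k%:R * h by rewrite mulr_ge0// ltW.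
  have kht : 0 <= k%:R * h <= t.
    by rewrite kh0 -nh ler_pM2r// ler_nat ltnW.
  have bS := sg_bounded S kh0.
  have -> : k.+1%:R * h = k%:R * h + h by rewrite -natr1 mulrDl mul1r.
  rewrite -natr1.
  have -> : S (k%:R * h + h) z - z - (k%:R * h + h)%:C *: q =
      (S (k%:R * h) z - z - (k%:R * h)%:C *: q) +
      h%:C *: (S (k%:R * h) (dq z h - gen S z) + (S (k%:R * h) (gen S z) - q)).
    rewrite [in RHS](blinB bS) subrKA scalerBr -(blinZ bS) -diff_quotientE// (blinB bS).
    by rewrite -(sgD _ kh0 (ltW h0)) rmorphD/= scalerDl; exact: subr_telescope.
  rewrite mulrDl mul1r; apply: (le_trans (rnormD _ _)).
  apply: lerD; first by apply: IH; exact: ltnW.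
  rewrite rnormZ gtr0_norm// ler_pM2l//; apply: (le_trans (rnormD _ _)).
  apply: lerD; last exact: Hc.
  apply: (le_trans (HM _ _ kht)).
  have := Hd h h0 hd; rewrite invfM mulrA ltr_pdivlMr// mulrC => /ltW.
  by [].
have := key n (leqnn n); rewrite nh mulrA nh mulrDr => /le_trans; apply.
by rewrite addrC mulrCA divff ?gt_eqF// mulr1.
Qed.

End Semigroup.

(** * Closedness of the generator and criteria for its boundedness *)

Section Resolvent.
Context (R : realType) (X : completeNormedModType R[i]) (S : c0semigroup X).
Context (l : R[i]) (hl : resolvent_set S l).
Implicit Types (x y z : X).

Lemma resolventP x : gen_dom S (resolvent S l x) /\
  l *: resolvent S l x - gen S (resolvent S l x) = x.
Proof.
have [y [Py _]] := hl.1 x.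
by apply: (@xgetPex _ 0 [set y | gen_dom S y /\ l *: y - gen S y = x]); exists y.
Qed.

Lemma resolvent_genK y : gen_dom S y -> resolvent S l (l *: y - gen S y) = y.
Proof.
move=> Dy; have [w [_ Hw]] := hl.1 (l *: y - gen S y).
by rewrite -[RHS](Hw y (conj Dy erefl)); apply/esym/Hw; exact: resolventP.
Qed.

(** With the bounded resolvent [R], passing to the limit in [z n = R (l z n - A z n)] gives
    [x = R (l x - y)], a point of the domain with image [y]. *)
Lemma gen_closed (z : nat -> X) x y : (forall n, gen_dom S (z n)) ->
  z n @[n --> \oo] --> x -> gen S (z n) @[n --> \oo] --> y ->
  gen_dom S x /\ gen S x = y.
Proof.
move=> Dz zx gy; have bR := hl.2.
have Rx : resolvent S l (l *: z n - gen S (z n)) @[n --> \oo] -->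
    resolvent S l (l *: x - y).
  by apply: blin_cvg => //; apply: cvgB => //; exact: cvgZr.
have xE : resolvent S l (l *: x - y) = x.
  apply: norm_cvg_unique Rx _ => /=; move: zx; apply: cvg_trans.
  by apply: near_eq_cvg; apply: nearW => n; rewrite resolvent_genK.
have [Dx gx] := resolventP (l *: x - y); rewrite xE in Dx gx; split => //.
by move: gx => /addrI/oppr_inj.
Qed.

(* l R x - (S(h) - 1) / h R x is in the domain and tends to l R x - A R x = x. *)
Lemma gen_dom_dense x (e : R) : 0 < e -> exists2 z, gen_dom S z & rnorm (z - x) < e.
Proof.
move=> e0; have [Dx gx] := resolventP x; set y := resolvent S l x in Dx gx.
have [d d0 Hd] := gen_rnorm Dx e0.
have h0 : 0 < d / 2 by rewrite divr_gt0.
exists (l *: y - diff_quotient S y (d / 2)).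
  apply: (genB _ _).1; first exact: (genZ _ Dx).1.
  by apply: (genZ _ _).1; apply: (genB _ Dx).1; exact: (gen_sg (ltW h0) Dx).1.
rewrite -[X in _ - X]gx opprB addrC subrKA.
by rewrite rdistC Hd//; lra.
Qed.

Lemma gen_dom_dense_seq x : exists z : nat -> X,
  (forall n, gen_dom S (z n)) /\ z n @[n --> \oo] --> x.
Proof.
have [n|z Hz] := @choice nat X (fun n z => gen_dom S z /\ rnorm (z - x) <= n.+1%:R^-1).
  have [|z Dz /ltW zx] := @gen_dom_dense x n.+1%:R^-1; first by rewrite invr_gt0.
  by exists z.
exists z; split => [n|]; first by have [] := Hz n.
apply: (@cvg_rnorm_le _ _ _ _ _ _ (fun n => n.+1%:R^-1)); last exact: cvg_harmonic.
by apply: nearW => n; have [] := Hz n.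
Qed.

(** Any [x] is a limit of points of the domain; the bound makes their images Cauchy, and closedness
    puts [x] in the domain. *)
Lemma bounded_generator_of_bound (K : R) :
  (forall z, gen_dom S z -> rnorm (gen S z) <= K * rnorm z) -> bounded_generator S.
Proof.
move=> HK; have DT : gen_dom S = setT.
  apply/seteqP; split => // x _; have [z [Dz zx]] := gen_dom_dense_seq x.
  suff /cvg_ex[y gy] : cvg (gen S (z n) @[n --> \oo]) by have [] := gen_closed Dz zx gy.
  apply: cauchy_rnorm => e e0.
  have K0 : 0 < `|K| + 1 by rewrite ltr_wpDl.
  have e1 : 0 < e / (`|K| + 1) / 2 by rewrite !divr_gt0.
  have /cvg_rnormP/cvgr0Pnorm_lt/(_ _ e1)[N _ HN] := zx.
  exists (gen S (z N)); exists N => // n /= Nn.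
  have [Dd gd] := genB (Dz n) (Dz N).
  rewrite -gd (le_lt_trans (HK _ Dd))//.
  have zn := HN n Nn; have zN := HN N (leqnn N).
  rewrite !(ger0_norm (rnorm_ge0 _)) in zn zN.
  have zz : rnorm (z n - z N) < e / (`|K| + 1).
    by have := rdist_tri x (z n) (z N); rewrite (rdistC x); lra.
  rewrite ltr_pdivlMr// mulrC in zz; apply: le_lt_trans zz.
  by rewrite ler_wpM2r ?rnorm_ge0// (le_trans (ler_norm _))// lerDl.
by split => //; exists K => x; apply: HK; rewrite DT.
Qed.

(** The mean value estimate with [q = A z] gives [t |A z| <= |S(t) z - z| + (t / 2) |A z|]. The last
    term is absorbed on the left, which leaves the bound [t^-1]. *)
Lemma bounded_generator_of_norm_continuity (t : R) : 0 < t ->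
  (forall r x, 0 <= r <= t -> gen_dom S x -> rnorm (S r x - x) <= 2^-1 * rnorm x) ->
  bounded_generator S.
Proof.
move=> t0 Ht.
(* The hypothesis is extended to all of [X] by density, since it will be applied to [gen S z]. *)
have Ht' r x : 0 <= r <= t -> rnorm (S r x - x) <= 2^-1 * rnorm x.
  move=> /[dup] rt /andP[r0 _]; have [z [Dz zx]] := gen_dom_dense_seq x.
  have bS := sg_bounded S r0.
  have h1 : rnorm (S r (z n) - z n) @[n --> \oo] --> rnorm (S r x - x).
    by apply: cvg_rnorm; apply: cvgB => //; exact: blin_cvg.
  have h2 : 2^-1 * rnorm (z n) @[n --> \oo] --> 2^-1 * rnorm x.
    by apply: cvgM; [exact: cvg_cst|exact: cvg_rnorm].
  rewrite -(cvg_lim _ h1)// -(cvg_lim _ h2)//.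
  apply: ler_lim; [exact: cvgP h1|exact: cvgP h2|].
  by apply: nearW => n; exact: Ht.
apply: (@bounded_generator_of_bound t^-1) => z Dz.
have := sg_mean_value (q := gen S z) (t := t) (c := 2^-1 * rnorm (gen S z)) Dz (ltW t0).
have c0 : 0 <= 2^-1 * rnorm (gen S z) by rewrite mulr_ge0 ?rnorm_ge0.
move=> /(_ c0 (fun r rt => Ht' r _ rt)) h.
have h1 : rnorm (S t z - z) <= 2^-1 * rnorm z by apply: Ht'; rewrite lexx ltW.
have h2 : t * rnorm (gen S z) <= rnorm (S t z - z) + t * (2^-1 * rnorm (gen S z)).
  rewrite -[t in X in X <= _]gtr0_norm// -rnormZ.
  have := rdist_tri (S t z - z) (t%:C *: gen S z) 0; rewrite !subr0 rdistC; lra.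
rewrite ler_pdivlMl//; have := rnorm_ge0 z; nra.
Qed.

End Resolvent.

(** * A gliding hump for the generator *)

Section GlidingHump.
Context (R : realType) (X : completeNormedModType R[i]) (S : c0semigroup X).
Context (I : Type) (z : I -> X) (lo : I -> R) (P : R -> I -> Prop) (c : R).
Hypothesis c0 : 0 < c.
(** There are two instances: bumps, where [lo] is a point below which the bump vanishes, so that
    [d n.+1 <= lo (i n)] separates the supports, and small continuous inputs, where [lo] is
    constantly 1. *)
Hypothesis hump : forall d : R, 0 < d -> exists i, [/\ P d i, gen_dom S (z i),
  rnorm (z i) <= d, c <= rnorm (gen S (z i)) & 0 < lo i].

(* The steps are chosen so small that some difference quotient of step h_n hardly sees
   the tail of the series, so that it stays close to A W_n, W_n being the partial sum;
   if the sum were in D(A), then A W_n would converge. *)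
Lemma gliding_hump : exists (i : nat -> I) (d : nat -> R),
  [/\ forall n, [/\ P (d n) (i n), gen_dom S (z (i n)) & rnorm (z (i n)) <= d n],
      forall n, [/\ 0 < d n, d n.+1 <= d n / 2 & d n.+1 <= lo (i n)], d 0%N = 1 &
      forall w, \sum_(k < n) z (i k) @[n --> \oo] --> w -> ~ gen_dom S w].
Proof.
(* A state holds the current partial sum, the bound [d] and the hump about to be added. *)
pose st : Type := (X * R * I)%type.
pose Q (s : st) := gen_dom S s.1.1 /\ 0 < s.1.2 /\ [/\ P s.1.2 s.2, gen_dom S (z s.2),
  rnorm (z s.2) <= s.1.2, c <= rnorm (gen S (z s.2)) & 0 < lo s.2].
pose r (s s' : st) := [/\ s'.1.1 = s.1.1 + z s.2, s'.1.2 <= s.1.2 / 2,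
  s'.1.2 <= lo s.2 & exists h : R, [/\ 0 < h, h <= s.1.2 &
  forall w, rnorm (w - s'.1.1) <= 2 * s'.1.2 ->
    rnorm (diff_quotient S w h - gen S s'.1.1) <= c / 4]].
have [i0 Hi0] := hump ltr01.
have [||f [f0 fQ fr]] := @invariant_dependent_choice st Q r (0, 1, i0).
- by split; [exact: (gen0 S).1|].
- move=> [[W d] i] [/= DW [d0 [_ Di _ _ lo0]]].
  have [DW' gW'] := genD DW Di.
  have c8 : 0 < c / 8 by rewrite divr_gt0.
  have [b b0 Hb] := gen_rnorm DW' c8.
  pose h := Num.min (b / 2) d.
  have h0 : 0 < h by rewrite lt_min divr_gt0.
  have hb : h < b by rewrite gt_min; apply/orP; left; lra.
  have hd : h <= d by rewrite ge_min lexx orbT.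
  have bS := sg_bounded S (ltW h0).
  have [M M1 HM] := blin_bound bS.
  have M0 : 0 < M + 1 by lra.
  (* The last term makes a perturbation of size [2 * d'] change the difference quotient of step [h]
     by at most [(M + 1) * 2 * d' / h <= c / 8]. The other [c / 8] comes from the choice of [h]
     below [b]. *)
  pose d' := Num.min (Num.min (d / 2) (lo i)) (c * h / (16 * (M + 1))).
  have d'0 : 0 < d' by rewrite !lt_min lo0 !divr_gt0 ?mulr_gt0.
  have [j Hj] := hump d'0.
  exists (W + z i, d', j); first by [].
  split => //=.
  + by rewrite !ge_min lexx.
  + by rewrite !ge_min lexx orbT.
  exists h; split => // w wW.
  have hw : 2 * d' * (M + 1) <= h * (c / 8).
    have : d' <= c * h / (16 * (M + 1)) by rewrite !ge_min lexx !orbT.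
    by rewrite ler_pdivlMr ?mulr_gt0//; lra.
  have D1 : rnorm (diff_quotient S w h - diff_quotient S (W + z i) h) <= c / 8.
    rewrite -diff_quotientB ?(ltW h0)// /diff_quotient.
    rewrite rnormZ gtr0_norm ?invr_gt0// ler_pdivrMl// (le_trans _ hw)//.
    rewrite (le_trans (rnormB _ _))//; have := HM (w - (W + z i)).
    have := rnorm_ge0 (w - (W + z i)); move: wW; nra.
  have := rdist_tri (diff_quotient S (W + z i) h) (diff_quotient S w h) (gen S (W + z i)).
  by have := Hb h h0 hb; lra.
pose W n := (f n).1.1; pose d n := (f n).1.2; pose i n := (f n).2.
exists i, d; split => [n|n||w].
- by have [_ [_ []]] := fQ n.
- by have [_ [? _]] := fQ n; have [_ ? ? _] := fr n.
- by rewrite /d f0.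
rewrite (_ : (fun n => _) = W); last first.
  apply/funext; elim => [|n IH]; first by rewrite big_ord0 /W f0.
  by rewrite big_ord_recr/= IH /W; have [-> _ _ _] := fr n.
move=> Ww Dw.
have d0 n : 0 <= d n by have [_ [/ltW ? _]] := fQ n.
have dh n : d n.+1 <= d n / 2 by have [] := fr n.
have Wd n : rnorm (W n.+1 - W n) <= d n.
  have [_ [_ [_ _ zd _ _]]] := fQ n; rewrite /W; have [-> _ _ _] := fr n.
  by rewrite addrC addKr.
have wW n := geometric_steps_lim d0 dh Wd n Ww.
have c4 : 0 < c / 8 by rewrite divr_gt0.
have [b b0 Hb] := gen_rnorm Dw c4.
have /cvgr0Pnorm_lt/(_ b b0)[N _ HN] := geometric_steps_cvg0 d0 dh.
(* Two such estimates put consecutive [gen S (W n)] within [3 c / 4] of each other, whereas they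
   differ by the image of a hump, of norm at least [c]. The bound [h <= d n] lets the steps tend to
   0. *)
have near_gen n : (N <= n)%N -> rnorm (gen S w - gen S (W n.+1)) <= c / 4 + c / 8.
  move=> Nn; have [_ _ _ [h [h0 hd Hh]]] := fr n.
  have := Hh w (wW n.+1); rewrite -/(W _) => h1.
  have hb : h < b by rewrite (le_lt_trans hd)// (le_lt_trans (ler_norm _))// HN.
  have := Hb h h0 hb; rewrite rdistC => h2.
  by have := rdist_tri (diff_quotient S w h) (gen S w) (gen S (W n.+1)); lra.
have h1 := near_gen N (leqnn N); have h2 := near_gen N.+1 (leqnSn N).
have [DW [_ [_ Dz _ cz _]]] := fQ N.+1.
have h3 : gen S (W N.+2) = gen S (W N.+1) + gen S (z (i N.+1)).
  by rewrite [W N.+2]/W; have [-> _ _ _] := fr N.+1; exact: (genD DW Dz).2.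
have := rdist_tri (gen S w) (gen S (W N.+2)) (gen S (W N.+1)).
rewrite (rdistC _ (gen S w)) h3 [_ + _ - _]addrAC subrr add0r -h3.
by rewrite -/(i N.+1) in cz; lra.
Qed.

End GlidingHump.

(** * Convolutions with the semigroup *)

Section Convolution.
Context (R : realType) (X : completeNormedModType R[i]) (S : c0semigroup X).
Local Notation mu := (@lebesgue_measure R).
Implicit Types (v w : R -> X) (tau t s r h : R).

Lemma left_continuous_orbit tau v t : 0 < t <= tau -> left_continuous_at v t ->
  left_continuous_at (fun s => S (tau - s) (v s)) t.
Proof.
move=> /andP[t0 tt] lvt e e0; have [M M1 HM] := sg_bounded_on S tau.
have M0 : 0 < M by lra.
have e2 : 0 < e / 2 by rewrite divr_gt0.
have [d1 d10 H1] := lvt (e / 2 / M) (divr_gt0 e2 M0).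
have tt' : 0 <= tau - t by rewrite subr_ge0.
have [d2 d20 H2] := sg_continuous_rnorm S (v t) tt' e2.
exists (Num.min (Num.min d1 d2) t); first by rewrite !lt_min d10 d20.
move=> r; rewrite ltrBlDr -ltrBlDl !lt_min => /andP[/andP[r1 r2] r3] rt.
have rtau : 0 <= tau - r <= tau by apply/andP; split; lra.
have bS := sg_bounded S (proj1 (andP rtau)).
apply: (le_lt_trans (rdist_tri (S (tau - r) (v t)) _ _)).
rewrite [e]splitr; apply: ltrD.
  rewrite -(blinB bS); apply: (le_lt_trans (HM _ _ rtau)).
  by rewrite mulrC -ltr_pdivlMr//; apply: H1 => //; lra.
by apply: H2; [case/andP: rtau|rewrite opprB addrC subrKA ger0_norm; lra].
Qed.

Lemma blc_convolution tau v : bounded_left_continuous 0 tau v ->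
  bounded_left_continuous 0 tau (fun s => S (tau - s) (v s)).
Proof.
move=> [[C vC] lv]; have [M M1 HM] := sg_bounded_on S tau.
have M0 : 0 < M by lra.
split.
  exists (M * C) => s /[dup] /vC vs /andP[s0 st].
  by rewrite (le_trans (HM _ _ _)) ?ler_pM2l//; apply/andP; split; lra.
move=> t /[dup] /lv lvt /andP[t0 tt]; apply: left_continuous_orbit => //.
by rewrite t0 ltW.
Qed.

Lemma convolutionB tau v w : 0 <= tau -> bounded_left_continuous 0 tau v ->
  bounded_left_continuous 0 tau w ->
  convolution S (fun s => v s - w s) tau = convolution S v tau - convolution S w tau.
Proof.
move=> tau0 bv bw; rewrite /convolution.
rewrite -bochner_integralB//; [|exact: blc_convolution..].
apply: bochner_integral_eq => //; first by apply: blc_convolution; exact: blcB.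
move=> s /andP[s0 st]; have bS := sg_bounded S (_ : 0 <= tau - s).
by rewrite (blinB (bS _))// subr_ge0.
Qed.

Lemma rnorm_convolution_bound tau v (M C : R) : 0 <= tau -> 0 <= M ->
  (forall t x, 0 <= t <= tau -> rnorm (S t x) <= M * rnorm x) ->
  bounded_left_continuous 0 tau v -> (forall s, 0 <= s <= tau -> rnorm (v s) <= C) ->
  rnorm (convolution S v tau) <= M * C * tau.
Proof.
move=> tau0 M0 HM bv vC; rewrite -[X in _ <= _ * X]subr0.
apply: rnorm_bochner_integral_bound => //; first exact: blc_convolution.
move=> s /[dup] /vC vs /andP[s0 st].
by rewrite (le_trans (HM _ _ _)) ?ler_wpM2l//; apply/andP; split; lra.
Qed.

Lemma rnorm_convolution_bound_on tau v (E : set R) (m M C : R) : 0 <= tau -> 0 <= M ->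
  (forall t x, 0 <= t <= tau -> rnorm (S t x) <= M * rnorm x) ->
  measurable E -> (mu E <= m%:E)%E -> 0 <= C ->
  bounded_left_continuous 0 tau v -> (forall s, 0 <= s <= tau -> rnorm (v s) <= C) ->
  (forall s, 0 <= s <= tau -> ~ E s -> v s = 0) ->
  rnorm (convolution S v tau) <= M * C * m.
Proof.
move=> tau0 M0 HM mE Em C0 bv vC vE; rewrite -[X in _ <= X]addr0 -(mul0r (tau - 0)).
apply: (rnorm_bochner_integral_bound_off _ mE) => //.
- exact: mulr_ge0.
- exact: blc_convolution.
- move=> s /[dup] /vC vs /andP[s0 st].
  by rewrite (le_trans (HM _ _ _)) ?ler_wpM2l//; apply/andP; split; lra.
move=> s /[dup] /vE vs /andP[s0 st] /vs ->.
by rewrite blin0 ?rnorm0//; apply: sg_bounded; rewrite subr_ge0.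
Qed.

Lemma blc_sg tau v h : 0 <= h -> bounded_left_continuous 0 tau v ->
  bounded_left_continuous 0 tau (fun s => S h (v s)).
Proof. by move=> h0; apply: (@blc_blin _ _ _ (S h)); exact: sg_bounded. Qed.

Lemma sg_convolution tau v h : 0 <= tau -> 0 <= h -> bounded_left_continuous 0 tau v ->
  S h (convolution S v tau) = convolution S (fun s => S h (v s)) tau.
Proof.
move=> tau0 h0 bv; rewrite /convolution -bochner_integral_blin//.
- apply: bochner_integral_eq => //.
    by apply: blc_blin; [exact: sg_bounded|exact: blc_convolution].
  by move=> s /andP[s0 st] /=; rewrite -!sgD ?subr_ge0// addrC.
- exact: sg_bounded.
- exact: blc_convolution.
Qed.

Lemma convolutionZ tau v (c : R[i]) : 0 <= tau -> bounded_left_continuous 0 tau v ->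
  convolution S (fun s => c *: v s) tau = c *: convolution S v tau.
Proof.
move=> tau0 bv; have bc : bounded_linear (fun x : X => c *: x).
  split; first by move=> a x y; rewrite scalerDr !scalerA mulrC.
  by exists (complex.Re `|c|) => x; rewrite rnormZc.
rewrite /convolution -(bochner_integral_blin bc)//; last exact: blc_convolution.
apply/esym/bochner_integral_eq => //.
  by apply: blc_blin => //; exact: blc_convolution.
move=> s /andP[s0 st] /=; have bS := sg_bounded S (_ : 0 <= tau - s).
by rewrite (blinZ (bS _))// subr_ge0.
Qed.

Lemma diff_quotient_convolution tau v h : 0 <= tau -> 0 <= h ->
  bounded_left_continuous 0 tau v ->
  diff_quotient S (convolution S v tau) h =
  convolution S (fun s => diff_quotient S (v s) h) tau.
Proof.
move=> tau0 h0 bv; rewrite /diff_quotient sg_convolution// -convolutionB//; last exact: blc_sg.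
by rewrite convolutionZ//; apply: blcB => //; exact: blc_sg.
Qed.

(** Past [tau] the integrand vanishes, and on [[0, tau]] the factor [S (t - tau)] comes out of the
    integral. This links the value at [tau] with values at later times. *)
Lemma convolution_shift tau t v : 0 <= tau <= t -> bounded_left_continuous 0 t v ->
  (forall s, tau < s -> v s = 0) ->
  convolution S v t = S (t - tau) (convolution S v tau).
Proof.
move=> /andP[tau0 tt] bv v0; have bS := sg_bounded S (_ : 0 <= t - tau).
have bv' : bounded_left_continuous 0 tau v.
  have [[C vC] lv] := bv; split.
    by exists C => s /andP[s0 st]; rewrite vC// s0 (le_trans st).
  by move=> s /andP[s0 st]; apply: lv; rewrite s0 (lt_le_trans st).
have b1 := blc_convolution bv.
rewrite /convolution (@bochner_integral_extend _ _ 0 t tau)//; last first.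
  by move=> s /andP[s1 s2]; rewrite v0// blin0//; apply: sg_bounded; rewrite subr_ge0.
rewrite -bochner_integral_blin//; [|by apply: bS; rewrite subr_ge0|exact: blc_convolution].
apply/esym/bochner_integral_eq => //.
  apply: blc_blin; last exact: blc_convolution.
  by apply: bS; rewrite subr_ge0.
move=> s /andP[s0 st] /=; rewrite -sgD ?subr_ge0//.
by rewrite addrA subrK.
Qed.

(** For an input along a single vector [x] the difference quotient falls on [x] alone, so it
    converges uniformly in [s]. *)
Lemma gen_convolution tau (phi : R -> R) x : 0 <= tau -> gen_dom S x ->
  (forall y, bounded_left_continuous 0 tau (fun s => (phi s)%:C *: y : X)) ->
  (forall s, 0 <= s <= tau -> `|phi s| <= 1) ->
  gen_dom S (convolution S (fun s => (phi s)%:C *: x) tau) /\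
  gen S (convolution S (fun s => (phi s)%:C *: x) tau) =
    convolution S (fun s => (phi s)%:C *: gen S x) tau.
Proof.
move=> tau0 Dx bphi phi1; apply: gen_cvg.
have [M M1 HM] := sg_bounded_on S tau.
apply: (@cvg_rnorm_le _ _ _ _ _ _
  (fun h => M * tau * rnorm (diff_quotient S x h - gen S x))); last first.
  rewrite -[X in _ --> X](mulr0 (M * tau)); apply: cvgM; first exact: cvg_cst.
  by apply/cvg_rnormP; exact: gen_domE.
near=> h; have h0 : 0 <= h by near: h; exact: nbhs_right_ge.
rewrite diff_quotient_convolution//.
rewrite (_ : (fun s => diff_quotient S _ h) = fun s => (phi s)%:C *: diff_quotient S x h).
  rewrite -convolutionB// mulrAC; apply: rnorm_convolution_bound => //; first by lra.
    exact: blcB.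
  move=> s /phi1 p1; rewrite -scalerBr rnormZ -[X in _ <= X]mul1r.
  by rewrite ler_wpM2r ?rnorm_ge0.
apply/funext => s; have := @diff_quotientZD _ _ S (phi s)%:C x 0 h h0.
rewrite addr0 => ->; rewrite {2}/diff_quotient blin0 ?subrr ?scaler0 ?addr0//.
exact: sg_bounded.
Unshelve. all: by end_near. Qed.

End Convolution.

(** * Increments of orbits as convolutions *)

Section OrbitIntegral.
Context (R : realType) (X : completeNormedModType R[i]) (S : c0semigroup X).
Implicit Types (x y : X) (tau t c : R).

(** The strict inequality [c < s] makes the indicator left continuous at its jump. *)
Lemma blc_indicator tau c y :
  bounded_left_continuous 0 tau (fun s => (if c < s then 1 else 0)%:C *: y).
Proof.
split.
  exists (rnorm y) => s _; case: ifP => _; first by rewrite scale1r.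
  by rewrite scale0r rnorm0 rnorm_ge0.
move=> s _ e e0; case: (ltP c s) => cs.
  exists (s - c); first by rewrite subr_gt0.
  by move=> r; rewrite opprB addrC subrK => -> _; rewrite subrr rnorm0.
exists 1 => // r _ rs; rewrite [c < r]ltNge (le_trans rs cs)/=.
by rewrite subrr rnorm0.
Qed.

(** Counted from the right end, the nodes see the semigroup at the times [j.+1 * h], and the
    indicator keeps those below [t]; [m] is their number. *)
Lemma riemann_sum_orbit tau t (n : nat) (g : X) : 0 < t <= tau -> (0 < n)%N ->
  exists m : nat, [/\ (m.+1 <= n)%N, t <= m.+1%:R * mesh 0 tau n,
    m.+1%:R * mesh 0 tau n <= t + mesh 0 tau n &
    riemann_sum 0 tau n
      (fun s => S (tau - s) ((if tau - t < s then 1 else 0)%:C *: g)) =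
    \sum_(j < m) (mesh 0 tau n)%:C *: S (j.+1%:R * mesh 0 tau n) g].
Proof.
move=> /andP[t0 tt] n0; set h := mesh 0 tau n.
have h0 : 0 <= h by apply: mesh_ge0; lra.
have nh : n%:R * h = tau by rewrite meshE// subr0.
have ex : exists m : nat, t <= m.+1%:R * h by exists n.-1; rewrite prednK// nh.
have mn : (ex_minn ex < n)%N.
  by case: ex_minnP => m _ /(_ n.-1); rewrite prednK// nh -[X in _ -> (m < X)%N]prednK// ltnS; exact.
case: ex_minnP mn => m tm mmin mn; exists m; split => //.
  case: m tm mmin {mn} => [|m] tm mmin; first by rewrite mul1r lerDr ltW.
  rewrite -natr1 mulrDl mul1r lerD2r leNgt; apply/negP => /ltW /mmin.
  by rewrite ltnn.
rewrite /riemann_sum (reindex_inj rev_ord_inj)/=.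
rewrite (big_ord_widen n (fun j => h%:C *: S (j.+1%:R * h) g) (ltnW mn)) [RHS]big_mkcond/=.
apply: eq_bigr => j _; rewrite add0r -/h.
have -> : (n - j.+1)%:R * h = tau - j.+1%:R * h by rewrite natrB// mulrBl nh.
rewrite opprB addrC subrK ltrD2l ltrN2.
have bS : bounded_linear (S (j.+1%:R * h)) by apply: sg_bounded; rewrite mulr_ge0.
have -> : (j.+1%:R * h < t) = (j < m)%N.
  have [jm|mj] := ltnP j m; first by rewrite ltNge; apply/negP => /mmin; rewrite leqNgt jm.
  by apply/negbTE; rewrite -leNgt (le_trans tm)// ler_wpM2r// ler_nat.
by case: ifP => _; [rewrite scale1r|rewrite scale0r blin0// scaler0].
Qed.

(** This is the formula [S(t) x - x = int_0^t S(s) A x ds]. Each term [h S(s) A x] of the Riemann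
    sum is close to [S(s + h) x - S(s) x], and these increments telescope. *)
Lemma convolution_orbit tau t x : 0 < t <= tau -> gen_dom S x ->
  convolution S (fun s => (if tau - t < s then 1 else 0)%:C *: gen S x) tau = S t x - x.
Proof.
move=> /[dup] ttau /andP[t0 tt] Dx; have tau0 : 0 < tau by lra.
have [M M1 HM] := sg_bounded_on S tau.
have M0 : 0 < M by lra.
have bb := blc_convolution S (blc_indicator tau (tau - t) (gen S x)).
apply: (norm_cvg_unique (riemann_sum_cvg (ltW tau0) bb)) => /=.
apply/cvg_rnormP/cvgr0Pnorm_lt => e e0.
have e3 : 0 < e / 3 by lra.
have [d1 d10 H1] := gen_rnorm Dx (divr_gt0 e3 (mulr_gt0 M0 tau0)).
have [d2 d20 H2] := sg_continuous_rnorm S x (ltW t0) e3.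
have [d3 d30 H3] := sg_continuous_rnorm S x (lexx 0) e3.
pose d := Num.min d1 (Num.min d2 d3).
have d0 : 0 < d by rewrite !lt_min d10 d20.
have [N _ HN] := @cvgr0_norm_lt _ _ _ _ _ _ (@cvg_harmonic R) (d / tau) (divr_gt0 d0 tau0).
exists N.+1 => // -[//|k] /= Nk; rewrite ger0_norm ?rnorm_ge0//.
set n := k.+1; set h := mesh 0 tau n.
have h0 : 0 < h by rewrite /h /mesh subr0 divr_gt0.
have nh : n%:R * h = tau by rewrite meshE// subr0.
have hd : h < d.
  have := HN k Nk; rewrite /harmonic/= ger0_norm// ltr_pdivlMr//.
  by rewrite /h /mesh subr0 mulrC.
move: hd; rewrite !lt_min => /andP[hd1 /andP[hd2 hd3]].
have [m [mn tm mt ->]] := riemann_sum_orbit (gen S x) ttau (ltn0Sn k).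
rewrite -/n -/h in mn tm mt *.
have mh : m%:R * h <= tau by rewrite -nh ler_pM2r// ler_nat ltnW.
(* The nodes start at [h], so the telescoped sum runs from [h] to [m.+1 * h]; [E2] and [E3] move
   these ends to [t] and 0. *)
have tel : \sum_(j < m) (S (j.+2%:R * h) x - S (j.+1%:R * h) x) =
    S (m.+1%:R * h) x - S h x.
  rewrite -(big_mkord xpredT (fun j => S (j.+2%:R * h) x - S (j.+1%:R * h) x)).
  by rewrite telescope_sumr// mul1r.
have E1 : rnorm (\sum_(j < m) h%:C *: S (j.+1%:R * h) (gen S x) -
    (S (m.+1%:R * h) x - S h x)) <= e / 3.
  rewrite -tel -sumrB; apply: (le_trans (rnorm_sum _ _ _)).
  apply: (@le_trans _ _ (\sum_(j < m) (h * (e / 3 / tau)))); last first.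
    rewrite sumr_const card_ord -[X in X <= _]mulr_natl mulrA.
    apply: (le_trans (ler_wpM2r _ mh)); first by apply: ltW; rewrite divr_gt0.
    by rewrite mulrC divfK// gt_eqF.
  apply: ler_sum => j _.
  have jh : 0 <= j.+1%:R * h <= tau.
    apply/andP; split; first by rewrite mulr_ge0// ltW.
    rewrite -[X in _ <= X]nh ler_pM2r// ler_nat.
    by rewrite (leq_trans (ltn_ord j))// ltnW.
  have bS := sg_bounded S (proj1 (andP jh)).
  have -> : S (j.+2%:R * h) x = S (j.+1%:R * h) (S h x).
    by rewrite -sgD ?(ltW h0) ?(proj1 (andP jh))// -[j.+2%:R]natr1 mulrDl mul1r.
  rewrite -(blinB bS) diff_quotientE// -(blinZ bS) -(blinB bS) -scalerBr.
  apply: (le_trans (HM _ _ jh)); rewrite rnormZ gtr0_norm// rdistC.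
  rewrite mulrCA ler_pM2l// mulrC -ler_pdivlMr//.
  have := H1 h h0 hd1; rewrite invfM mulrA => /ltW.
  by rewrite mulrAC.
have E2 : rnorm (S (m.+1%:R * h) x - S t x) < e / 3.
  by apply: H2; [rewrite mulr_ge0// ltW|rewrite ger0_norm; lra].
have E3 : rnorm (S h x - x) < e / 3.
  by rewrite -[X in _ - X](@sg0 _ _ S); apply: H3; [exact: ltW|rewrite subr0 gtr0_norm].
set Y := \sum_(j < m) _ in E1 *.
have := rdist_tri (S (m.+1%:R * h) x - S h x) Y (S t x - x).
have : rnorm (S (m.+1%:R * h) x - S h x - (S t x - x)) <=
    rnorm (S (m.+1%:R * h) x - S t x) + rnorm (S h x - x).
  by rewrite opprB [x - _]addrC addrACA [- _ + x]addrC -[x - _]opprB rnormB.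
lra.
Qed.

End OrbitIntegral.

Lemma cvgZ_real (R : realType) (V : normedModType R[i]) (T : Type) (F : set_system T)
    (FF : Filter F) (phi : T -> R) (f : T -> V) (c : R) (l : V) :
  phi x @[x --> F] --> c -> f x @[x --> F] --> l ->
  (phi x)%:C *: f x @[x --> F] --> c%:C *: l.
Proof.
move=> pc fl; apply: (@cvg_rnorm_le _ _ _ _ _ _
  (fun x => `|phi x - c| * rnorm (f x) + `|c| * rnorm (f x - l))).
  apply: nearW => x; rewrite (le_trans (rdist_tri (c%:C *: f x) _ _))//.
  by rewrite -scalerBl -scalerBr -rmorphB/= !rnormZ.
rewrite [X in _ --> X](_ : _ = `|c - c| * rnorm l + `|c| * 0); last first.
  by rewrite subrr normr0 mul0r mulr0 addr0.
apply: cvgD; apply: cvgM.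
- by apply: cvg_norm; apply: cvgB => //; exact: cvg_cst.
- exact: cvg_rnorm.
- exact: cvg_cst.
- exact/cvg_rnormP.
Qed.

(** * A continuous cut-off function *)

Section Trapezoid.
Context (R : realType) (a b d : R) (d0 : 0 < d).

Definition trapezoid (r : R) : R :=
  Num.max 0 (Num.min 1 (Num.min ((r - a) / d) ((b - r) / d))).

Lemma trapezoid_continuous : continuous trapezoid.
Proof.
pose f (r : R) : R := (r - a) / d; pose g (r : R) : R := (b - r) / d.
have cf : continuous f.
  move=> r; apply: cvgM; last exact: cvg_cst.
  by apply: cvgB; [exact: cvg_id|exact: cvg_cst].
have cg : continuous g.
  move=> r; apply: cvgM; last exact: cvg_cst.
  by apply: cvgB; [exact: cvg_cst|exact: cvg_id].
move=> r; apply: (@continuous_max R R (cst 0) (cst 1 \min (f \min g)) r).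
  exact: cvg_cst.
apply: continuous_min; first exact: cvg_cst.
by apply: continuous_min; [exact: cf|exact: cg].
Qed.

Lemma trapezoid_ge0 r : 0 <= trapezoid r.
Proof. by rewrite le_max lexx. Qed.

Lemma trapezoid_le1 r : trapezoid r <= 1.
Proof. by rewrite ge_max ler01 ge_min lexx. Qed.

Lemma trapezoid_out r : (r <= a) || (b <= r) -> trapezoid r = 0.
Proof.
move=> rab; rewrite /trapezoid; apply/max_idPl; rewrite !ge_min.
case/orP: rab => h; apply/orP; right; apply/orP; [left|right];
  by rewrite pmulr_lle0 ?invr_gt0// subr_le0.
Qed.

Lemma trapezoid_in r : a + d <= r <= b - d -> trapezoid r = 1.
Proof.
move=> /andP[h1 h2]; rewrite /trapezoid.
have -> : Num.min 1 (Num.min ((r - a) / d) ((b - r) / d)) = 1.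
  apply/min_idPl; rewrite le_min; apply/andP.
  by split; rewrite ler_pdivlMr// mul1r; lra.
by apply/max_idPr.
Qed.

End Trapezoid.

(** * Bounded inputs and bumps for an unbounded generator *)

Section InputRegularity.
Context (R : realType) (X : completeNormedModType R[i]) (S : c0semigroup X).
Local Notation mu := (@lebesgue_measure R).

Lemma cvg_left_continuous (v : R -> X) (s : R) :
  v r @[r --> s] --> v s -> left_continuous_at v s.
Proof.
move=> /cvg_rnormP/cvgr0Pnorm_lt vs e e0.
have /nbhs_ballP[d /= d0 Hd] := vs e e0.
exists d => // r r1 r2; have := Hd r; rewrite /ball/= ger0_norm ?subr_ge0//.
by rewrite ger0_norm ?rnorm_ge0//; apply; lra.
Qed.

Lemma blc_of_continuous (tau C : R) (v : R -> X) :
  (forall s, 0 <= s <= tau -> rnorm (v s) <= C) ->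
  (forall s, s < tau -> v r @[r --> s] --> v s) -> bounded_left_continuous 0 tau v.
Proof.
move=> vC cv; split; first by exists C.
by move=> t /andP[_ tt]; apply: cvg_left_continuous; exact: cv.
Qed.

(* L^oo-maximal regularity at time tau, tested on inputs whose only discontinuity is at
   tau. *)
Definition bounded_input_regular (tau : R) : Prop := forall v : R -> X,
  (forall s, rnorm (v s) <= 1) -> (forall s, s < tau -> v r @[r --> s] --> v s) ->
  gen_dom S (convolution S v tau).

Context (l : R[i]) (hl : resolvent_set S l).

Lemma cvg_reflect (u : R -> X) (tau s : R) : continuous u ->
  u (tau - r) @[r --> s] --> u (tau - s).
Proof.
move=> cu; apply: (@cvg_comp _ _ _ (fun r => tau - r) u _ (nbhs (tau - s))); last exact: cu.
by apply: cvgB; [exact: cvg_cst|exact: cvg_id].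
Qed.

(** As A is unbounded, some small [r] and unit vector [x1] of the domain satisfy
    [|S(r) x1 - x1| > 1/2]. The input equal to [x1] during the last [r] units of time would give
    [S(r) x1 - x1] under A; a trapezoid in its place is continuous and vanishes near [tau], and
    changes the result by at most 1/4. The bump is written in the reflected variable [tau - s]. *)
Lemma unbounded_bump (tau : R) : 0 < tau -> ~ bounded_generator S ->
  forall d : R, 0 < d -> exists (lo : R) (u : R -> X),
    [/\ 0 < lo, forall r, rnorm (u r) <= 1, continuous u &
        forall r, (r <= lo) || (d <= r) -> u r = 0] /\
    let z := convolution S (fun s => u (tau - s)) tau in
    [/\ gen_dom S z, rnorm z <= d & 4^-1 <= rnorm (gen S z)].
Proof.
move=> tau0 nb d d0.
have [M M1 HM] := sg_bounded_on S tau; have M0 : 0 < M by lra.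
(* [r <= d / M] bounds the convolution by [M * r <= d] and, as [M >= 1], also keeps the support
   below [d]. *)
pose t0 := Num.min tau (d / M).
have t00 : 0 < t0 by rewrite lt_min tau0 divr_gt0.
have [r [x [/andP[r0 rt] Dx Hx]]] : exists r x, [/\ 0 <= r <= t0, gen_dom S x &
    2^-1 * rnorm x < rnorm (S r x - x)].
  apply: contrapT => H; apply: nb; apply: (bounded_generator_of_norm_continuity hl t00).
  move=> r x rt Dx; rewrite leNgt; apply/negP => h; apply: H; by exists r, x.
move: rt; rewrite le_min => /andP[rtau rd].
have r_gt0 : 0 < r.
  rewrite lt_neqAle r0 andbT; apply/eqP => r00; move: Hx.
  rewrite -r00 sg0 subrr rnorm0 ltNge mulr_ge0 ?rnorm_ge0//.
have x0 : 0 < rnorm x.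
  rewrite lt_neqAle rnorm_ge0 andbT; apply/eqP => /esym/rnorm_eq0 x00; move: Hx.
  by rewrite x00 blin0 ?subrr ?rnorm0 ?mulr0 ?ltxx//; exact: sg_bounded.
pose x1 := (rnorm x)^-1%:C *: x.
have [Dx1 _] := genZ (rnorm x)^-1%:C Dx; rewrite -/x1 in Dx1.
have nx1 : rnorm x1 = 1 by rewrite rnormZ gtr0_norm ?invr_gt0// mulVf// gt_eqF.
have Hx1 : 2^-1 < rnorm (S r x1 - x1).
  rewrite (blinZ (sg_bounded S r0)) -scalerBr rnormZ gtr0_norm ?invr_gt0//.
  by rewrite mulrC ltr_pdivlMr.
set g := gen S x1.
(* Trapezoid and indicator differ only on a set of measure at most [3 * del], which costs
   [3 * M * |g| * del <= 3 / 12]. The summand 1 keeps [D] positive when [g = 0]. *)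
pose D := 12 * (M * (rnorm g + 1)).
have D0 : 0 < D by rewrite !mulr_gt0// ltr_wpDl// rnorm_ge0.
pose del := D^-1; have del0 : 0 < del by rewrite invr_gt0.
pose phi := trapezoid del r del.
have cphi (y : X) : continuous (fun rho => (phi rho)%:C *: y : X).
  by move=> rho; apply: cvgZ_real; [exact: trapezoid_continuous|exact: cvg_cst].
have phi1 rho : `|phi rho| <= 1 by rewrite ger0_norm ?trapezoid_ge0 ?trapezoid_le1.
have bphi (y : X) : bounded_left_continuous 0 tau (fun s => (phi (tau - s))%:C *: y).
  apply: (@blc_of_continuous _ (rnorm y)).
    by move=> s _; rewrite rnormZ -[X in _ <= X]mul1r ler_wpM2r ?rnorm_ge0.
  by move=> s _; exact: (@cvg_reflect (fun rho => (phi rho)%:C *: y) tau s (cphi y)).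
have [Dz gz] := @gen_convolution _ _ S tau (fun s => phi (tau - s)) x1 (ltW tau0) Dx1 bphi
  (fun s _ => phi1 (tau - s)).
exists del, (fun rho => (phi rho)%:C *: x1); split.
  split => //.
    by move=> rho; rewrite rnormZ nx1 mulr1.
  move=> rho h; rewrite /phi trapezoid_out// ?scale0r//.
  case/orP: h => [->//|h]; apply/orP; right; rewrite (le_trans rd)//.
  by rewrite (le_trans _ h)// ler_pdivrMr// ler_peMr// ltW.
split => //.
  have := @rnorm_convolution_bound_on _ _ S tau (fun s => (phi (tau - s))%:C *: x1)
    (`[tau - r, tau]%classic) r M 1 (ltW tau0) (ltW M0) HM (measurable_itv _) _ ler01
    (bphi x1) _ _.
  rewrite mulr1 => h; apply: (@le_trans _ _ (M * r)); last first.
    by rewrite mulrC -ler_pdivlMr.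
  apply: h.
  - by rewrite (le_trans (measure_itv_le _)) ?lee_fin; lra.
  - by move=> s _; rewrite rnormZ nx1 mulr1.
  move=> s /andP[_ st]; rewrite /= in_itv/= st andbT => /negP; rewrite -ltNge => h.
  by rewrite /phi trapezoid_out ?scale0r//; apply/orP; right; lra.
rewrite gz -/g.
have rtau' : 0 < r <= tau by rewrite r_gt0.
have orb := convolution_orbit rtau' Dx1; rewrite -/g in orb.
have bind := blc_indicator tau (tau - r) g.
have diff := convolutionB S (ltW tau0) bind (bphi g).
have : rnorm (convolution S (fun s => (if tau - r < s then 1 else 0)%:C *: g -
    (phi (tau - s))%:C *: g) tau) <= M * rnorm g * (del + del + del).
  apply: (@rnorm_convolution_bound_on _ _ S tau _
    (`[tau - (del + del), tau]%classic `|` `[tau - r, tau - r + del]%classic)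
    _ M _ (ltW tau0) (ltW M0) HM).
  - by apply: measurableU; exact: measurable_itv.
  - rewrite (le_trans (measureU2 _ _ _)) ?EFinD//; try exact: measurable_itv.
    apply: leeD; rewrite (le_trans (measure_itv_le _)) ?lee_fin//; lra.
  - exact: rnorm_ge0.
  - exact: blcB.
  - move=> s _; rewrite -scalerBl -rmorphB/= rnormZ -[X in _ <= X]mul1r.
    rewrite ler_wpM2r ?rnorm_ge0//; have := trapezoid_ge0 del r del (tau - s).
    have := trapezoid_le1 del r del (tau - s); rewrite -/(phi _).
    by case: ifP => _; rewrite ler_norml => h1 h2; apply/andP; split; lra.
  move=> s /andP[s0 st] nE; rewrite -scalerBl -rmorphB/=.
  suff -> : (if tau - r < s then 1 else 0) = phi (tau - s) by rewrite subrr scale0r.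
  case: ltP => h; last by rewrite /phi trapezoid_out//; apply/orP; right; lra.
  rewrite /phi trapezoid_in//; apply/andP; split; rewrite leNgt; apply/negP => h2; apply: nE.
    by left; rewrite /= in_itv/=; apply/andP; split; lra.
  by right; rewrite /= in_itv/=; apply/andP; split; lra.
rewrite diff orb => h1.
have h2 : M * rnorm g * (del + del + del) <= 4^-1.
  have : M * rnorm g * del <= 12^-1.
    rewrite ler_pdivrMr//.
    by rewrite /D; lra.
  lra.
have := rdist_tri (convolution S (fun s => (phi (tau - s))%:C *: g) tau) (S r x1 - x1) 0.
by rewrite !subr0; lra.
Qed.

End InputRegularity.

(** * Boundedness of the generator from regularity for bounded inputs *)

Section InputRegularityBounded.
Context (R : realType) (X : completeNormedModType R[i]) (S : c0semigroup X).
Context (l : R[i]) (hl : resolvent_set S l).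

Lemma continuous_sum (u : nat -> R -> X) (n : nat) :
  (forall k, continuous (u k)) -> continuous (fun r => \sum_(k < n) u k r).
Proof.
move=> cu r; elim: n => [|n IH].
  by rewrite (_ : (fun r => _) = cst 0);
    [exact: cvg_cst|apply/funext => s; rewrite big_ord0].
rewrite (_ : (fun r => _) = fun r => \sum_(k < n) u k r + u n r); last first.
  by apply/funext => s; rewrite big_ord_recr.
by apply: cvgD => //; exact: cu.
Qed.

Lemma convolutionB_sum (tau : R) (v : R -> X) (u : nat -> R -> X) (n : nat) : 0 <= tau ->
  bounded_left_continuous 0 tau v -> (forall k, bounded_left_continuous 0 tau (u k)) ->
  bounded_left_continuous 0 tau (fun s => v s - \sum_(k < n) u k s) /\
  convolution S (fun s => v s - \sum_(k < n) u k s) tau =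
  convolution S v tau - \sum_(k < n) convolution S (u k) tau.
Proof.
move=> tau0 bv bu; elim: n => [|n [bn IH]].
  rewrite (_ : (fun s => _) = v); last by apply/funext => s; rewrite big_ord0 subr0.
  by rewrite big_ord0 subr0.
rewrite (_ : (fun s => _) = fun s => (v s - \sum_(k < n) u k s) - u n s); last first.
  by apply/funext => s; rewrite big_ord_recr/= opprD addrA.
by rewrite convolutionB// IH big_ord_recr/= opprD addrA; split => //; exact: blcB.
Qed.

(* If A is unbounded, unit bumps with disjoint supports accumulating at tau add up to an
   admissible input whose convolution lies outside D(A). *)
Lemma bounded_generator_of_input_regularity (tau : R) : 0 < tau ->
  bounded_input_regular S tau -> bounded_generator S.
Proof.
move=> tau0 Hreg; apply: contrapT => nb.
have [M M1 HM] := sg_bounded_on S tau; have M0 : 0 < M by lra.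
pose I : Type := (R * (R -> X))%type.
pose z (p : I) := convolution S (fun s => p.2 (tau - s)) tau.
pose P (d : R) (p : I) := [/\ forall r, rnorm (p.2 r) <= 1, continuous p.2 &
  forall r, (r <= p.1) || (d <= r) -> p.2 r = 0].
have c0 : (0 : R) < 4^-1 by lra.
have hump (d : R) : 0 < d -> exists i : I, [/\ P d i, gen_dom S (z i),
    rnorm (z i) <= d, 4^-1 <= rnorm (gen S (z i)) & 0 < i.1].
  move=> /(unbounded_bump hl tau0 nb)[lo [u [[? ? ? ?] [? ? ?]]]].
  by exists (lo, u); split.
have [i [d [Hi Hd d01 nD]]] := gliding_hump c0 hump.
pose u k := (i k).2; pose U n r := \sum_(k < n) u k r.
have d_gt0 n : 0 < d n by have [] := Hd n.
have dh n : d n.+1 <= d n / 2 by have [] := Hd n.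
have d_le n m : (n <= m)%N -> d m <= d n.
  by apply: geometric_steps_le => // k; exact: ltW.
have u1 k r : rnorm (u k r) <= 1 by have [[H _ _] _ _] := Hi k; exact: H.
have cu k : continuous (u k) by have [[_ H _] _ _] := Hi k; exact: H.
(* The threshold [d n] separates the supports: the bumps before [n] live above it, those from [n] on
   below it. *)
have u_low k n r : (k < n)%N -> r < d n -> u k r = 0.
  move=> kn rd; have [[_ _ +] _ _] := Hi k; apply; apply/orP; left.
  have [_ _ dlo] := Hd k; rewrite (le_trans (ltW rd))// (le_trans _ dlo)//.
  exact: d_le.
have u_high k n r : (n <= k)%N -> d n <= r -> u k r = 0.
  move=> nk dr; have [[_ _ +] _ _] := Hi k; apply; apply/orP; right.
  by rewrite (le_trans _ dr)// d_le.
have U_low n r : r < d n -> U n r = 0.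
  by move=> rd; rewrite /U big1// => k _; exact: (u_low _ n).
have U1 n r : rnorm (U n r) <= 1.
  elim: n => [|n IH]; first by rewrite /U big_ord0 rnorm0.
  rewrite /U big_ord_recr/= -/(U n r); have [dr|rd] := leP (d n) r.
    by rewrite (u_high n n)// addr0.
  by rewrite U_low// add0r.
have U_stable n m r : d n <= r -> (n <= m)%N -> U m r = U n r.
  move=> dr; elim: m => [|m IH]; first by rewrite leqn0 => /eqP ->.
  rewrite leq_eqVlt => /predU1P[->//|nm]; rewrite /U big_ord_recr/= -/(U m r).
  by rewrite IH// (u_high m n)// addr0.
have d_cvg0 : d n @[n --> \oo] --> (0 : R).
  by apply: geometric_steps_cvg0 => // n; exact: ltW.
have [r|N HN] := @choice R nat (fun r n => 0 < r -> d n <= r).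
  have [r0|r0] := ltP 0 r; last by exists 0%N.
  have /cvgr0Pnorm_lt/(_ r r0)[n _ Hn] := d_cvg0.
  by exists n => _; rewrite (le_trans (ler_norm _))// ltW// Hn/=.
(* [v] is the sum of all reflected bumps: before [tau] the partial sums have stabilised from index
   [N (tau - s)] on. From [tau] on, [v] is 0. *)
pose v s := if s < tau then U (N (tau - s)) (tau - s) else 0.
have vE s n : d n <= tau - s -> v s = U n (tau - s).
  move=> dn; have ts : 0 < tau - s by exact: lt_le_trans dn.
  rewrite /v -subr_gt0 ts; have [nN|/ltnW Nn] := leqP n (N (tau - s)).
    exact: U_stable.
  by apply/esym/U_stable => //; exact: HN.
have v1 s : rnorm (v s) <= 1 by rewrite /v; case: ifP => // _; rewrite rnorm0.
have cv s : s < tau -> v r @[r --> s] --> v s.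
  move=> st; have ts : 0 < (tau - s) / 2 by rewrite divr_gt0// subr_gt0.
  have dn := HN _ ts; set n := N _ in dn.
  rewrite (vE s n); last by lra.
  apply: (@cvg_trans _ (U n (tau - r) @[r --> s])); last first.
    apply: (@cvg_reflect _ _ (U n) tau s).
    exact: (@continuous_sum u n cu).
  apply: near_eq_cvg; near=> r; rewrite (vE r n)//.
  have : r < s + (tau - s) / 2 by near: r; apply: lt_nbhsl; lra.
  lra.
have bv : bounded_left_continuous 0 tau v by exact: (blc_of_continuous (fun s _ => v1 s) cv).
have bu k : bounded_left_continuous 0 tau (fun s => u k (tau - s)).
  apply: (blc_of_continuous (fun s _ => u1 k (tau - s))) => s _.
  exact: (@cvg_reflect _ _ (u k)).
apply: (nD (convolution S v tau)); last exact: Hreg.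
(* The remainder of the input is only bounded by 1, but it lives on an interval of length [d n]. *)
apply: (@cvg_rnorm_le _ _ _ _ _ _ (fun n => M * 1 * d n)); last first.
  by rewrite mulr1 -[X in _ --> X](mulr0 M); apply: cvgM => //; exact: cvg_cst.
apply: nearW => n; rewrite rdistC.
have [bn <-] := convolutionB_sum n (ltW tau0) bv bu.
apply: (@rnorm_convolution_bound_on _ _ S tau _ (`[tau - d n, tau]%classic)
  _ M 1 (ltW tau0) (ltW M0) HM) => //.
- by rewrite (le_trans (measure_itv_le _)) ?lee_fin; have := d_gt0 n; lra.
- move=> s _; have [dn|dn] := leP (d n) (tau - s).
    by rewrite (vE s n)// subrr rnorm0.
  by rewrite -/(U n (tau - s)) U_low// subr0.
move=> s /andP[_ st]; rewrite /= in_itv/= st andbT => /negP; rewrite -ltNge => h.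
by rewrite (vE s n) ?subrr//; lra.
Unshelve. all: by end_near. Qed.

End InputRegularityBounded.

(** * Admissibility and maximal regularity *)

Section Extrapolation.
Context (R : realType) (X : completeNormedModType R[i]) (S : c0semigroup X).
Context (l : R[i]) (hl : resolvent_set S l).
Context (Y : completeNormedModType R[i]) (j : X -> Y).
Context (hY : is_extrapolation_space S l j).
Context (T : c0semigroup Y) (hT : extends_semigroup S j T).
Implicit Types (x y z : X) (h t : R).

Lemma resolvent_sg h x : 0 <= h -> resolvent S l (S h x) = S h (resolvent S l x).
Proof.
move=> h0; have [Dx gx] := resolventP hl x.
have [DSx gSx] := gen_sg h0 Dx; have bS := sg_bounded S h0.
by rewrite -[RHS](resolvent_genK hl)// gSx -(blinZ bS) -(blinB bS) gx.
Qed.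

Lemma resolvent_diff_quotient h x : 0 <= h ->
  resolvent S l (diff_quotient S x h) = diff_quotient S (resolvent S l x) h.
Proof.
by move=> h0; rewrite /diff_quotient (blinZ hl.2) (blinB hl.2) resolvent_sg.
Qed.

Lemma resolvent_diff_quotient_cvg x :
  resolvent S l (diff_quotient S x h) @[h --> 0^'+] --> gen S (resolvent S l x).
Proof.
have [Dx _] := resolventP hl x.
move: (gen_domE Dx); apply: cvg_trans; apply: near_eq_cvg; near=> h.
by rewrite resolvent_diff_quotient//; near: h; exact: nbhs_right_ge.
Unshelve. all: by end_near. Qed.

Lemma bounded_linear_extrapolation : bounded_linear j.
Proof.
have [lj nj _] := hY; split => //; have [M _ HM] := blin_bound hl.2.
by exists M => x; rewrite nj.
Qed.

Let bj := bounded_linear_extrapolation.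

Lemma diff_quotient_extrapolation x h : 0 <= h ->
  diff_quotient T (j x) h = j (diff_quotient S x h).
Proof. by move=> h0; rewrite /diff_quotient (blinZ bj) (blinB bj) hT. Qed.

(** The norm of [j] is that of the resolvent, which turns difference quotients of [x] into those of
    [resolvent S l x], a point of the domain. Hence the quotients are Cauchy in [Y]. *)
Lemma gen_dom_extrapolation x : gen_dom T (j x).
Proof.
have [_ nj _] := hY.
suff : cvg (j (diff_quotient S x h) @[h --> 0^'+]).
  move=> /cvg_ex[y jy]; apply/cvg_ex; exists y; move: jy; apply: cvg_trans.
  apply: near_eq_cvg; near=> h.
  by rewrite diff_quotient_extrapolation//; near: h; exact: nbhs_right_ge.
apply: cauchy_rnorm => e e0.
have e2 : 0 < e / 2 by rewrite divr_gt0.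
have /cvg_rnormP/cvgr0Pnorm_lt/(_ _ e2) := @resolvent_diff_quotient_cvg x.
move=> near_e; have [h0 Hh0] := @filter_ex _ _ (at_right_proper_filter (0 : R)) _ near_e.
exists (j (diff_quotient S x h0)); apply: filterS near_e => h.
rewrite !(ger0_norm (rnorm_ge0 _)) in Hh0 *.
rewrite -(blinB bj) nj (blinB hl.2) => Hh.
have := rdist_tri (gen S (resolvent S l x)) (resolvent S l (diff_quotient S x h))
  (resolvent S l (diff_quotient S x h0)).
by rewrite [rnorm (gen _ _ - _)]rdistC; lra.
Unshelve. all: by end_near. Qed.

Lemma gen_extrapolation_sg x t : 0 <= t ->
  T t (gen T (j x)) = gen T (j (S t x)).
Proof.
by move=> t0; rewrite -hT// (gen_sg t0 (@gen_dom_extrapolation x)).2.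
Qed.

(* If A_{-1} j z = j y, then applying R(l, A) to difference quotients gives A R z = R y,
   so that z = l R z - R y lies in D(A). *)
Lemma gen_dom_of_extrapolation z y : gen T (j z) = j y -> gen_dom S z.
Proof.
move=> zy; have [_ nj _] := hY.
have zc : diff_quotient T (j z) h @[h --> 0^'+] --> j y.
  exact: (gen_domP (@gen_dom_extrapolation z) zy).
have Rc : resolvent S l (diff_quotient S z h) @[h --> 0^'+] --> resolvent S l y.
  apply/cvg_rnormP; move/cvg_rnormP: zc; apply: cvg_trans; apply: near_eq_cvg.
  near=> h; rewrite diff_quotient_extrapolation; last by near: h; exact: nbhs_right_ge.
  by rewrite -(blinB bj) nj (blinB hl.2).
have e : gen S (resolvent S l z) = resolvent S l y.
  exact: (norm_cvg_unique (@resolvent_diff_quotient_cvg z) Rc).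
have [Dz gz] := resolventP hl z.
rewrite -gz e; apply: (genB _ (resolventP hl y).1).1.
exact: (genZ _ Dz).1.
Unshelve. all: by end_near. Qed.

Lemma input_regular_of_admissible :
  Linfty_admissible j T (fun x => gen T (j x)) ->
  exists2 tau : R, 0 < tau & bounded_input_regular S tau.
Proof.
move=> [bB [tau tau0 Hu]]; exists tau => // v v1 cv.
have bv : bounded_left_continuous 0 tau v by exact: (blc_of_continuous (fun s _ => v1 s) cv).
have vL : Linfty tau v.
  split; first exact: (bochner_integralP (ltW tau0) bv).1.
  by exists 1; apply: aeW => t _; exact: v1.
have [y _ jy] := Hu v vL.
apply: (@gen_dom_of_extrapolation _ y); rewrite jy /input_map /convolution.
have bc := blc_convolution S bv.
rewrite -(bochner_integral_blin bB (ltW tau0) bc).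
apply: (bochner_integral_eq (ltW tau0)); first exact: (blc_blin bB).
by move=> t /andP[t0 tt] /=; rewrite gen_extrapolation_sg// subr_ge0.
Qed.

Lemma gen_extrapolationE x : gen_dom S x -> gen T (j x) = j (gen S x).
Proof.
move=> Dx; apply: (gen_cvg _).2.
have : j (diff_quotient S x h) @[h --> 0^'+] --> j (gen S x).
  by apply: blin_cvg => //; exact: gen_domE.
apply: cvg_trans; apply: near_eq_cvg; near=> h.
by rewrite diff_quotient_extrapolation//; near: h; exact: nbhs_right_ge.
Unshelve. all: by end_near. Qed.

(** For bounded A, [x = l R x - A R x] bounds [|x|] by a multiple of [|R x| = |j x|]. So preimages
    of a sequence converging in [Y] are Cauchy, and the dense range of [j] is closed. Admissibility
    then holds trivially, every value of the input map being in the range. *)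
Lemma extrapolation_surjective : bounded_generator S -> forall y : Y, range j y.
Proof.
move=> [DT [K HK]] y; have [_ nj dj] := hY.
pose N : R := complex.Re `|l| + `|K|.
have N0 : 0 <= N.
  by rewrite addr_ge0// normc_def /= sqrtr_ge0.
have Nx x : rnorm x <= N * rnorm (j x).
  have [Dx gx] := resolventP hl x; rewrite nj -{1}gx.
  rewrite (le_trans (rnormB _ _))// rnormZc mulrDl lerD2l (le_trans (HK _))//.
  by rewrite ler_wpM2r ?rnorm_ge0// ler_norm.
have [n|x Hx] := @choice nat X (fun n x => rnorm (j x - y) < n.+1%:R^-1).
  have e0 : (0 : R[i]) < (n.+1%:R^-1)%:C by rewrite ltcR invr_gt0.
  have [|z [+ [x _ xz]]] := dj ((ball y (n.+1%:R^-1)%:C)^°) _ (open_interior _).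
    by exists y; apply: nbhs_singleton; apply: nbhs_interior; exact: nbhsx_ballx.
  rewrite -xz => /interior_subset; rewrite -ball_normE/= rnormE ltcR rdistC => h.
  by exists x.
have jx : j (x n) @[n --> \oo] --> y.
  apply: (@cvg_rnorm_le _ _ _ _ _ _ (fun n => n.+1%:R^-1)); last exact: cvg_harmonic.
  by apply: nearW => n; exact: ltW.
have /cvg_ex[x' xx'] : cvg (x n @[n --> \oo]).
  apply: (@cauchy_seq_rnorm _ _ _ (fun n => N * (n.+1%:R^-1 + n.+1%:R^-1))).
    move=> n m nm; rewrite (le_trans (Nx _))// ler_wpM2l// (blinB bj).
    have hm : rnorm (j (x m) - y) <= n.+1%:R^-1.
      by rewrite (le_trans (ltW (Hx m)))// lef_pV2 ?posrE// ler_nat.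
    rewrite (le_trans (rdist_tri y _ _))//; apply: lerD => //.
    by rewrite rdistC ltW.
  rewrite [X in _ --> X](_ : _ = N * (0 + 0)); last by rewrite addr0 mulr0.
  by apply: cvgM; [exact: cvg_cst|apply: cvgD; exact: cvg_harmonic].
exists x' => //; apply: norm_cvg_unique jx => /=.
exact: blin_cvg.
Qed.

Lemma admissible_of_bounded : bounded_generator S ->
  Linfty_admissible j T (fun x => gen T (j x)).
Proof.
move=> bA; split; last by exists 1 => // u _; exact: extrapolation_surjective.
have [DT [K HK]] := bA; have D x : gen_dom S x by rewrite DT.
split.
  move=> c x y; rewrite !gen_extrapolationE// (gen_linear c (D x) (D y)).2.
  by rewrite (blinD bj) (blinZ bj).
have [M M1 HM] := blin_bound bj; exists (M * K) => x.
by rewrite gen_extrapolationE// (le_trans (HM _))// -mulrA ler_pM2l//; lra.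
Qed.

End Extrapolation.

(** * The Favard space and regularity for continuous inputs *)

Section MaximalRegularity.
Context (R : realType) (X : completeNormedModType R[i]) (S : c0semigroup X).
Context (l : R[i]) (hl : resolvent_set S l).
Local Notation mu := (@lebesgue_measure R).
Implicit Types (u v : R -> X) (tau t s h : R).

Lemma favard_of_bound x (C : R) :
  (forall h, 0 < h -> h < 1 -> rnorm (S h x - x) <= C * h) -> favard S x.
Proof.
move=> H; rewrite /favard/= limf_esupE.
apply: (@le_lt_trans _ _ C%:E); last exact: ltry.
apply: (@le_trans _ _ (ereal_sup
    ((fun t : R => (t^-1 * rnorm (S t x - x))%:E) @` [set t | 0 < t < 1]))).
  apply: ereal_inf_lbound; exists [set t | 0 < t < 1] => //.
  near=> t; apply/andP; split; near: t; first exact: nbhs_right_gt.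
  exact: nbhs_right_lt.
apply: ge_ereal_sup => _ [t /= /andP[t0 t1] <-].
by rewrite lee_fin ler_pdivrMl// mulrC H.
Unshelve. all: by end_near. Qed.

(** The mean value estimate with [q = 0]. *)
Lemma sg_lipschitz (tau M : R) x t : 0 <= M ->
  (forall t x, 0 <= t <= tau -> rnorm (S t x) <= M * rnorm x) ->
  gen_dom S x -> 0 <= t <= tau -> rnorm (S t x - x) <= t * (M * rnorm (gen S x)).
Proof.
move=> M0 HM Dx /andP[t0 tt].
have := @sg_mean_value _ _ S x 0 t (M * rnorm (gen S x)) Dx t0.
rewrite scaler0 subr0; apply; first by rewrite mulr_ge0 ?rnorm_ge0.
by move=> r /andP[r0 rt]; rewrite subr0 HM// r0 (le_trans rt).
Qed.

Lemma gen_dom_favard : gen_dom S `<=` favard S.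
Proof.
move=> x Dx; have [M M1 HM] := sg_bounded_on S 1.
apply: (@favard_of_bound _ (M * rnorm (gen S x))) => h h0 h1.
by rewrite mulrC (sg_lipschitz (tau := 1))//; [lra|rewrite !ltW].
Qed.

Lemma negligible_itv_dense (P : R -> Prop) a b : a < b -> 
  {ae mu, forall t, P t} -> exists t, a < t < b /\ P t.
Proof.
move=> ab [N [mN N0 subN]]; apply: contrapT => H.
have : (mu `]a, b[%classic <= mu N)%E.
  apply: le_measure; rewrite ?inE//.
  move=> t /=; rewrite in_itv/= => abt; apply: subN => /= Pt; apply: H.
  by exists t.
rewrite N0 lebesgue_measure_itv/= lte_fin ab -EFinB lee_fin.
by rewrite leNgt subr_gt0 ab.
Qed.

(** Vanishing from [tau] on makes the convolution after [tau] an orbit starting at its value at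
    [tau]. *)
Definition continuous_input tau u := continuous u /\ forall s, tau <= s -> u s = 0.

Lemma blc_continuous_input tau u a : continuous_input tau u ->
  bounded_left_continuous 0 a u.
Proof.
move=> [cu u0]; have [a0|a0] := ltP a 0.
  split; first by exists 0 => s /andP[s0 sa]; have := le_lt_trans (le_trans s0 sa) a0; rewrite ltxx.
  by move=> t _; apply: cvg_left_continuous; exact: cu.
have [|c _ Hc] := @EVT_max R (fun t => rnorm (u t)) 0 a a0.
  apply: continuous_subspaceT => t; apply: (@cvg_rnorm R X); exact: cu.
apply: (@blc_of_continuous _ _ _ (rnorm (u c))) => [s sa|s _]; last exact: cu.
by apply: Hc; rewrite in_itv.
Qed.

(** The hypothesis speaks of almost every time, possibly not of [tau]. With [tau] inside []0, T[],
    good times [t n] tend to [tau] from the right; there the convolution is an orbit converging to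
    its value at [tau], its images [g (t n)] converge, and closedness applies. *)
Lemma maximal_regularity_gen_dom : C_maximal_regularity S -> exists2 tau : R, 0 < tau &
  forall u, continuous_input tau u -> gen_dom S (convolution S u tau).
Proof.
move=> [T T0 HT]; exists (T / 2); first by rewrite divr_gt0.
set tau := T / 2; have tau0 : 0 < tau by rewrite divr_gt0.
have tauT : tau < T by rewrite /tau; lra.
move=> u uin; have [cu u0] := uin.
have [g cg Hg] := HT u (continuous_subspaceT cu).
have [n|t Ht] := @choice nat R (fun n t => tau < t < T /\ t < tau + n.+1%:R^-1 /\
    gen_dom S (convolution S u t) /\ gen S (convolution S u t) = g t).
  have [|t [/andP[t1 +] Pt]] := @negligible_itv_dense _ tau
      (Num.min T (tau + n.+1%:R^-1)) _ Hg.
    by rewrite lt_min tauT ltrDl invr_gt0 ltr0n.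
  rewrite lt_min => /andP[t2 t3]; exists t; rewrite t1 t2; split => //; split => //.
  by apply: Pt; rewrite /= in_itv/= t2 andbT (lt_trans tau0).
have tT n : tau < t n < T by have [] := Ht n.
have t_cvg : t n @[n --> \oo] --> tau.
  apply/cvgrPdist_le => e e0; near=> n.
  have [/andP[t1 t2] [t3 _]] := Ht n.
  have : n.+1%:R^-1 < e by near: n; exact: (near_infty_natSinv_lt (PosNum e0)).
  move=> ne; rewrite ler0_norm; last by lra.
  by rewrite opprB lerBlDl (ltW (lt_trans t3 _))// ltrD2l.
have shift n : convolution S u (t n) = S (t n - tau) (convolution S u tau).
  apply: convolution_shift.
  - by have /andP[/ltW t1 _] := tT n; rewrite t1 ltW.
  - exact: (blc_continuous_input _ uin).
  - by move=> s /ltW; exact: u0.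
have Sc : S (t n - tau) (convolution S u tau) @[n --> \oo] --> convolution S u tau.
  apply/cvg_rnormP/cvgr0Pnorm_lt => e e0.
  have [d d0 Hd] := sg_continuous_rnorm S (convolution S u tau) (lexx 0) e0.
  have /cvgr_dist_lt/(_ d d0) := t_cvg; apply: filterS => n.
  have /andP[t1 _] := tT n.
  rewrite distrC => tn; rewrite ger0_norm ?rnorm_ge0//.
  rewrite -[X in _ - X](@sg0 _ _ S); apply: Hd; first by rewrite subr_ge0 ltW.
  by rewrite subr0.
have gc : g (t n) @[n --> \oo] --> g tau.
  apply/cvg_rnormP/cvgr0Pnorm_lt => e e0.
  have /within_continuous_rnormP/(_ tau) := cg; rewrite /= in_itv/=.
  rewrite !ltW// => /(_ isT e e0)[d d0 Hd].
  have /cvgr_dist_lt/(_ d d0) := t_cvg; apply: filterS => n.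
  rewrite distrC => tn; rewrite ger0_norm ?rnorm_ge0//; apply: Hd => //.
  by have /andP[t1 t2] := tT n; rewrite /= in_itv/= (ltW t2) (ltW (lt_trans tau0 t1)).
apply: (gen_closed hl _ Sc _).1.
- by move=> n; rewrite -shift; have [_ [_ []]] := Ht n.
- move: gc; apply: cvg_trans; apply: near_eq_cvg; apply: nearW => n.
  by rewrite -shift; have [_ [_ [_ ->]]] := Ht n.
Unshelve. all: by end_near. Qed.

End MaximalRegularity.

(** * From continuous to bounded inputs *)

Section MaximalRegularityConverse.
Context (R : realType) (X : completeNormedModType R[i]) (S : c0semigroup X).
Context (l : R[i]) (hl : resolvent_set S l).
Local Notation mu := (@lebesgue_measure R).
Implicit Types (u v : R -> X) (t s h : R).

Lemma uniform_sum_continuous_input (tau : R) (u : nat -> R -> X) (d : nat -> R) :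
  (forall n, 0 < d n) -> (forall n, d n.+1 <= d n / 2) ->
  (forall n, continuous_input tau (u n)) -> (forall n s, rnorm (u n s) <= d n) ->
  exists2 v, continuous_input tau v &
    forall n s, rnorm (v s - \sum_(k < n) u k s) <= 2 * d n.
Proof.
move=> d_gt0 dh uin ud; have d0 n : 0 <= d n by exact: ltW.
pose U s n := \sum_(k < n) u k s.
have Ud s n : rnorm (U s n.+1 - U s n) <= d n.
  by rewrite /U big_ord_recr/= addrAC subrr add0r.
have [s|v Hv] := @choice R X (fun s y => U s n @[n --> \oo] --> y).
  by have /cvg_ex := geometric_steps_cvg d0 dh (Ud s).
have vU n s : rnorm (v s - U s n) <= 2 * d n.
  exact: (geometric_steps_lim d0 dh (Ud s) n (Hv s)).
exists v => //; split.
  move=> s; apply/cvg_rnormP/cvgr0Pnorm_lt => e e0.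
  have e4 : 0 < e / 8 by lra.
  have /cvgr0Pnorm_lt/(_ _ e4)[n _ /(_ n (leqnn n))] := geometric_steps_cvg0 d0 dh.
  rewrite ger0_norm// => dn.
  have cU : U r n @[r --> s] --> U s n.
    by apply: (@continuous_sum _ _ u n) => k; have [] := uin k.
  have e4' : 0 < e / 2 by lra.
  move/cvg_rnormP/cvgr0Pnorm_lt/(_ _ e4') : cU; apply: filterS => r.
  rewrite !ger0_norm ?rnorm_ge0// => h.
  have := rdist_tri (U r n) (v r) (v s); have := rdist_tri (U s n) (U r n) (v s).
  have := vU n r; have := vU n s; rewrite (rdistC (v s)).
  lra.
move=> s ts; apply: norm_cvg_unique (Hv s) _ => /=.
rewrite (_ : U s = cst 0); first exact: cvg_cst.
by apply/funext => n; rewrite /U big1// => k _; exact: (uin k).2.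
Qed.

(* A Banach-Steinhaus argument: inputs with arbitrarily small norm and A (S * u)(tau) of
   norm at least 1 would add up uniformly to a continuous input with S * u outside D(A). *)
Lemma maximal_regularity_bound (tau : R) : 0 < tau ->
  (forall u, continuous_input tau u -> gen_dom S (convolution S u tau)) ->
  exists2 K : R, 0 <= K & forall u, continuous_input tau u -> (forall s, rnorm (u s) <= 1) ->
    rnorm (gen S (convolution S u tau)) <= K.
Proof.
move=> tau0 HD; apply: contrapT => nK.
have [M M1 HM] := sg_bounded_on S tau; have M0 : 0 < M by lra.
pose P (d : R) u := continuous_input tau u /\ forall s, rnorm (u s) <= d.
have hump (d : R) : 0 < d -> exists u, [/\ P d u, gen_dom S (convolution S u tau),
    rnorm (convolution S u tau) <= d, 1 <= rnorm (gen S (convolution S u tau)) &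
    (0 : R) < 1].
  (* Scaling by [c] brings the input and its convolution, of norm at most [M * c * tau], below [d].
     An input whose image under A exceeds [c^-1] keeps norm at least 1 after scaling. *)
  move=> d0; pose c := d / (M * tau + 1).
  have Mt : 0 < M * tau by rewrite mulr_gt0.
  have c0 : 0 < c by rewrite divr_gt0// ltr_wpDr.
  have cd : c <= d by rewrite ler_pdivrMr ?ltr_wpDr// ler_peMr//; lra.
  have [u [uin u1 Ku]] : exists u, [/\ continuous_input tau u, forall s, rnorm (u s) <= 1 &
      c^-1 < rnorm (gen S (convolution S u tau))].
    apply: contrapT => H; apply: nK; exists c^-1; first by rewrite ltW// invr_gt0.
    move=> u uin u1; rewrite leNgt; apply/negP => h; apply: H; by exists u.
  have bu := blc_continuous_input tau uin.
  have [Dcu gcu] := genZ c%:C (HD u uin).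
  have cE : convolution S (fun s => c%:C *: u s) tau = c%:C *: convolution S u tau.
    by apply: convolutionZ => //; exact: ltW.
  have cuin : continuous_input tau (fun s => c%:C *: u s).
    split; last by move=> s /(uin.2) ->; rewrite scaler0.
    by move=> s; apply: cvgZ_real; [exact: cvg_cst|exact: uin.1].
  have cu s : rnorm (c%:C *: u s) <= c.
    by rewrite rnormZ gtr0_norm// -[X in _ <= X]mulr1 ler_pM2l.
  exists (fun s => c%:C *: u s); rewrite cE; split => //.
  - by split => // s; exact: le_trans (cu s) cd.
  - rewrite -cE.
    have := rnorm_convolution_bound (ltW tau0) (ltW M0) HM
      (blc_continuous_input tau cuin) (fun s _ => cu s).
    move=> /le_trans; apply; rewrite mulrAC /c mulrCA ler_piMr//; first exact: ltW.
    by rewrite ler_pdivrMr ?mul1r; lra.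
  - rewrite gcu rnormZ gtr0_norm// -ler_pdivrMl// mulr1.
    exact: ltW.
have [u [d [Hu Hd d1 nD]]] := gliding_hump ltr01 hump.
have d_gt0 n : 0 < d n by have [] := Hd n.
have dh n : d n.+1 <= d n / 2 by have [] := Hd n.
have uin n : continuous_input tau (u n) by have [[]] := Hu n.
have ud n s : rnorm (u n s) <= d n by have [[_ H] _ _] := Hu n; exact: H.
have [v vin vu] := uniform_sum_continuous_input d_gt0 dh uin ud.
apply: (nD (convolution S v tau)); last exact: HD.
apply: (@cvg_rnorm_le _ _ _ _ _ _ (fun n => M * tau * (2 * d n))); last first.
  rewrite [X in _ --> X](_ : _ = M * tau * (2 * 0)); last by rewrite !mulr0.
  apply: cvgM; first exact: cvg_cst; apply: cvgM; first exact: cvg_cst.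
  by apply: geometric_steps_cvg0 => // n; exact: ltW.
apply: nearW => n; rewrite rdistC mulrAC.
have [bn <-] := convolutionB_sum S n (ltW tau0) (blc_continuous_input tau vin)
  (fun k => blc_continuous_input tau (uin k)).
exact: (rnorm_convolution_bound (ltW tau0) (ltW M0) HM bn (fun s _ => vu n s)).
Qed.

Lemma input_regular_of_favard : favard S = gen_dom S -> C_maximal_regularity S ->
  exists2 tau : R, 0 < tau & bounded_input_regular S tau.
Proof.
move=> favD /(maximal_regularity_gen_dom hl)[tau tau0 HD]; exists tau => // v v1 cv.
have [K K0 HK] := maximal_regularity_bound tau0 HD.
have [M M1 HM] := sg_bounded_on S tau; have M0 : 0 < M by lra.
have [M' M'1 HM'] := sg_bounded_on S 1.
have bv : bounded_left_continuous 0 tau v by exact: (blc_of_continuous (fun s _ => v1 s) cv).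
pose del n : R := n.+1%:R^-1.
have del0 n : 0 < del n by rewrite invr_gt0 ltr0n.
(* The left ramp is pushed before 0, so the cut-off is 1 on [[0, tau - del n]] and descends to 0 at
   [tau]. *)
pose w n s := (trapezoid (- del n) tau (del n) s)%:C *: v s.
have b1 n s : `|trapezoid (- del n) tau (del n) s| <= 1.
  by rewrite ger0_norm ?trapezoid_ge0// trapezoid_le1.
have w1 n s : rnorm (w n s) <= 1.
  by rewrite /w rnormZ -[X in _ <= X]mulr1 ler_pM ?rnorm_ge0.
have win n : continuous_input tau (w n).
  split; last by move=> s ts; rewrite /w trapezoid_out ?scale0r// ts orbT.
  move=> s; have [st|ts] := ltP s tau.
    by apply: cvgZ_real; [exact: trapezoid_continuous|exact: cv].
  apply: (@cvg_rnorm_le _ _ _ _ _ _ (fun r => trapezoid (- del n) tau (del n) r)).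
    apply: nearW => r; rewrite /w [trapezoid _ _ _ s]trapezoid_out ?ts ?orbT//.
    rewrite scale0r subr0 rnormZ ger0_norm ?trapezoid_ge0//.
    by rewrite -[X in _ <= X]mulr1 ler_wpM2l// trapezoid_ge0.
  have := @trapezoid_continuous R (- del n) tau (del n) s.
  by rewrite /continuous_at [trapezoid _ _ _ s]trapezoid_out ?ts ?orbT.
have bw n := blc_continuous_input tau (win n).
have wv : convolution S (w n) tau @[n --> \oo] --> convolution S v tau.
  apply: (@cvg_rnorm_le _ _ _ _ _ _ (fun n => M * 2 * del n)); last first.
    rewrite -[X in _ --> X](mulr0 (M * 2)); apply: cvgM; first exact: cvg_cst.
    exact: cvg_harmonic.
  apply: nearW => n; rewrite -convolutionB//; last exact: ltW.
  apply: (@rnorm_convolution_bound_on _ _ S tau _ (`[tau - del n, tau]%classic)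
    _ M 2 (ltW tau0) (ltW M0) HM) => //.
  - by rewrite (le_trans (measure_itv_le _)) ?lee_fin; have := del0 n; lra.
  - exact: blcB.
  - by move=> s _; rewrite (le_trans (rnormB _ _))// (_ : 2 = 1 + 1)// lerD.
  move=> s /andP[s0 st]; rewrite /= in_itv/= st andbT => /negP; rewrite -ltNge => h.
  by rewrite /w trapezoid_in ?scale1r ?subrr// addNr s0 ltW.
(* The Lipschitz bound [h * (M' * K)] on the increments is uniform in [n] and survives the limit;
   membership in the domain need not. *)
rewrite -favD; apply: (@favard_of_bound _ _ _ _ (M' * K)) => h h0 h1.
have bS := sg_bounded S (ltW h0).
have cw : S h (convolution S (w n) tau) - convolution S (w n) tau @[n --> \oo] -->
    S h (convolution S v tau) - convolution S v tau.
  by apply: cvgB => //; exact: blin_cvg.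
apply: (rnorm_lim_le cw); apply: nearW => n; rewrite mulrC.
have M'0 : 0 <= M' by lra.
have h01 : 0 <= h <= 1 by rewrite !ltW.
apply: (le_trans (sg_lipschitz M'0 HM' (HD _ (win n)) h01)).
by rewrite ler_pM2l// ler_wpM2l// HK.
Qed.

End MaximalRegularityConverse.

(** * Maximal regularity for bounded generators *)

Section BoundedGenerator.
Context (R : realType) (X : completeNormedModType R[i]) (S : c0semigroup X).
Hypothesis bA : bounded_generator S.
Local Notation mu := (@lebesgue_measure R).

(** Up to time [t] the integrands for [t'] and [t] differ by [(S(t' - t) - 1) S(t - s) f(s)], of
    norm at most [(t' - t) N] because A is bounded; this gives [N * tau]. The interval from [t] to
    [t'] accounts for [2 * (M * C)]. *)
Lemma convolution_lipschitz (f : R -> X) (tau C : R) : 0 <= tau -> 0 <= C ->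
  (forall s, 0 <= s <= tau -> rnorm (f s) <= C) ->
  (forall s, 0 < s <= tau -> left_continuous_at f s) ->
  exists2 L : R, 0 <= L & forall t t', 0 <= t -> t <= t' -> t' <= tau ->
    rnorm (convolution S f t' - convolution S f t) <= L * (t' - t).
Proof.
move=> tau0 C0 fC lf; have [DT [K HK]] := bA.
have D x : gen_dom S x by rewrite DT.
have [M M1 HM] := sg_bounded_on S tau; have M0 : 0 < M by lra.
pose N := M * `|K| * M * C.
have N0 : 0 <= N by rewrite !mulr_ge0// ltW.
have MC0 : 0 <= M * C by rewrite mulr_ge0// ltW.
exists (2 * (M * C) + N * tau) => [|t t' t0 tt' t'tau].
  by apply: addr_ge0; apply: mulr_ge0.
have blcf a : a <= tau -> bounded_left_continuous 0 a f.
  move=> atau; split.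
    by exists C => s /andP[s0 sa]; rewrite fC// s0 (le_trans sa).
  by move=> s /andP[s0 sa]; apply: lf; rewrite s0 ltW// (lt_le_trans sa).
have t'0 : 0 <= t' by lra.
have ttau : t <= tau by lra.
(* The integrand for [t] is extended by 0 to [[0, t']]; including [s = t] in the first case keeps
   [F] left continuous at the jump. *)
pose F s := if s <= t then S (t - s) (f s) else 0.
have FC s : 0 <= s <= t' -> rnorm (F s) <= M * C.
  move=> /andP[s0 st']; rewrite /F; case: ifP => st; last by rewrite rnorm0.
  rewrite (le_trans (HM _ _ _)) ?ler_pM2l ?fC//; apply/andP; split; lra.
have bF : bounded_left_continuous 0 t' F.
  split; first by exists (M * C).
  move=> s /andP[s0 st'] e e0; have [st|ts] := leP s t.
    have sin : 0 < s <= t by rewrite s0.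
    have lfs : left_continuous_at f s by apply: lf; rewrite s0 (le_trans st).
    have [d d0 Hd] := left_continuous_orbit S sin lfs e0.
    exists d => // r r1 r2; rewrite /F st (le_trans r2 st).
    exact: Hd.
  exists (s - t); first by rewrite subr_gt0.
  move=> r r1 r2; rewrite /F !ifF ?subrr ?rnorm0//; apply/negbTE; rewrite -ltNge; lra.
have FE : bochner_integral 0 t' F = convolution S f t.
  rewrite (bochner_integral_extend t0 tt' bF); last first.
    by move=> s /andP[ts _]; rewrite /F leNgt ts.
  apply/esym/bochner_integral_eq => //; first by apply: blc_convolution; exact: blcf.
  by move=> s /andP[_ st]; rewrite /F st.
have bG := blc_convolution S (blcf t' t'tau).
rewrite -FE /convolution -bochner_integralB//.
have GC s : 0 <= s <= t' -> rnorm (S (t' - s) (f s)) <= M * C.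
  move=> /andP[s0 st']; rewrite (le_trans (HM _ _ _)) ?ler_pM2l ?fC//; apply/andP; split; lra.
have itv_tt' := measure_itv_le tt'.
apply: (le_trans (rnorm_bochner_integral_bound_off (C := 2 * (M * C)) (D := (t' - t) * N)
  t'0 (measurable_itv _) itv_tt' _ _ (blcB bG bF) _ _)).
- by rewrite mulr_ge0.
- by rewrite mulr_ge0// subr_ge0.
- by move=> s st; have := rnormB (S (t' - s) (f s)) (F s); have := FC s st; have := GC s st; lra.
- move=> s /andP[s0 st']; rewrite /= in_itv/= st' andbT => /negP; rewrite -ltNge => st.
  rewrite /F (ltW st).
  have -> : S (t' - s) (f s) = S (t' - t) (S (t - s) (f s)).
    by rewrite -sgD ?subr_ge0 ?(ltW st)// addrA subrK.
  have tin : 0 <= t' - t <= tau by apply/andP; split; lra.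
  apply: (le_trans (sg_lipschitz (ltW M0) HM (D _) tin)).
  rewrite ler_wpM2l ?subr_ge0// /N -!mulrA ler_pM2l//.
  apply: (le_trans (HK _)); apply: (@le_trans _ _ (`|K| * rnorm (S (t - s) (f s)))).
    by rewrite ler_wpM2r ?rnorm_ge0// ler_norm.
  rewrite ler_wpM2l// (le_trans (HM _ _ _)) ?ler_pM2l ?fC//; apply/andP; split; lra.
have : (t' - t) * N * t' <= (t' - t) * N * tau.
  by rewrite ler_wpM2l// mulr_ge0// subr_ge0.
rewrite subr0; lra.
Qed.

(** The continuous representative is A (S * f) itself: S * f is Lipschitz and A is bounded. *)
Lemma maximal_regularity_of_bounded : C_maximal_regularity S.
Proof.
have [DT [K HK]] := bA; have D x : gen_dom S x by rewrite DT.
exists 1 => // f cf; exists (fun t => gen S (convolution S f t)); last first.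
  by apply: aeW => t _.
have [|c _ Hc] := @EVT_max R (fun t => rnorm (f t)) 0 1 ler01.
  apply/subspace_continuousP => t t0; apply: (@cvg_rnorm R X).
  by move/subspace_continuousP: cf; exact.
have fc s : 0 <= s <= 1 -> rnorm (f s) <= rnorm (f c).
  by move=> s01; apply: Hc; rewrite in_itv.
have lf s : 0 < s <= 1 -> left_continuous_at f s.
  move=> /andP[s0 s1] e e0; have /within_continuous_rnormP/(_ s) := cf.
  rewrite /= in_itv/= (ltW s0) s1 => /(_ isT e e0)[d d0 Hd].
  exists (Num.min d s); first by rewrite lt_min d0.
  move=> r; rewrite ltrBlDr -ltrBlDl lt_min => /andP[r1 r2] rs.
  apply: Hd; first by rewrite /= in_itv/=; apply/andP; split; lra.
  by rewrite ler0_norm; lra.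
have [L L0 HL] := convolution_lipschitz ler01 (rnorm_ge0 _) fc lf.
have N0 : 0 < `|K| * L + 1 by rewrite ltr_wpDl// mulr_ge0.
apply/within_continuous_rnormP => t; rewrite /= in_itv/= => /andP[t0 t1] e e0.
exists (e / (`|K| * L + 1)); first by rewrite divr_gt0.
move=> s; rewrite in_itv/= => /andP[s0 s1] st.
rewrite -(genB (D _) (D _)).2 (le_lt_trans (HK _))//.
apply: (@le_lt_trans _ _ ((`|K| * L + 1) * `|s - t|)); last by rewrite mulrC -ltr_pdivlMr.
have cst' : rnorm (convolution S f s - convolution S f t) <= L * `|s - t|.
  have [le_st|/ltW le_ts] := leP s t.
    by rewrite rdistC ler0_norm ?subr_le0// opprB HL.
  by rewrite ger0_norm ?subr_ge0// HL.
apply: (@le_trans _ _ (`|K| * (L * `|s - t|))).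
  apply: (le_trans (ler_wpM2r (rnorm_ge0 _) (ler_norm K))).
  by rewrite ler_wpM2l.
by rewrite mulrA ler_wpM2r// lerDl.
Qed.

End BoundedGenerator.

Theorem theorem2p9 (R : realType) (X : completeNormedModType R[i])
    (S : c0semigroup X)
    (l : R[i]) (hl : resolvent_set S l)
    (Xm1 : completeNormedModType R[i]) (j : X -> Xm1)
    (hXm1 : is_extrapolation_space S l j)
    (Sm1 : c0semigroup Xm1) (hSm1 : extends_semigroup S j Sm1) :
  (Linfty_admissible j Sm1 (fun x => gen Sm1 (j x)) <->
     (favard S = gen_dom S /\ C_maximal_regularity S)) /\
  ((favard S = gen_dom S /\ C_maximal_regularity S) <-> bounded_generator S).
Proof.
have adm_bdd : Linfty_admissible j Sm1 (fun x => gen Sm1 (j x)) -> bounded_generator S.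
  move=> /(input_regular_of_admissible hl hXm1 hSm1)[tau tau0].
  exact: (bounded_generator_of_input_regularity hl tau0).
have fav_bdd : favard S = gen_dom S /\ C_maximal_regularity S -> bounded_generator S.
  move=> [favD /(input_regular_of_favard hl favD)[tau tau0]].
  exact: (bounded_generator_of_input_regularity hl tau0).
have bdd_fav : bounded_generator S -> favard S = gen_dom S /\ C_maximal_regularity S.
  move=> bA; split; last exact: maximal_regularity_of_bounded.
  by apply/seteqP; split; [rewrite bA.1|exact: gen_dom_favard].
have bdd_adm := admissible_of_bounded hl hXm1 hSm1.
by split; split; [move=> /adm_bdd/bdd_fav|move=> /fav_bdd/bdd_adm|exact: fav_bdd|exact: bdd_fav].
Qed.
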